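(* Let the setting described in the context hold and assume $C_{\mathrm{DRO}}>-\infty$. Let $(\tau,\boldsymbol\xi_{\mathrm{in}},\boldsymbol\xi_{\mathrm{eq}})$ be feasible for (Dual), where $\mathrm{supp}(\tau)$ is a finite set, and let $\mathcal V$ be an arbitrary finite set satisfying $\mathrm{supp}(\tau)\subseteq\mathcal V\subset\mathcal S_2^*$. Assume that $\boldsymbol x\in\mathcal S_1$, $f_1,\dots,f_d\in\mathcal C_{\mathrm{cvx}}(\mathbb R)$ satisfy, with respect to some $\varepsilon_{\mathrm{OT}}>0$: (C1) $\langle\mathbf Q\boldsymbol x+\mathbf b,\boldsymbol\lambda\rangle+\sum_{i=1}^d f_i(\langle\mathbf p_i,\boldsymbol\lambda\rangle)=0$ for all $\boldsymbol\lambda\in\mathrm{supp}(\tau)$; (C2) $\langle\mathbf Q\boldsymbol x+\mathbf b,\boldsymbol\lambda\rangle+\sum_{i=1}^d f_i(\langle\mathbf p_i,\boldsymbol\lambda\rangle)\le0$ for all $\boldsymbol\lambda\in\mathcal V\setminus\mathrm{supp}(\tau)$; (C3) $\langle\mathbf L_{\mathrm{in}}\boldsymbol x-\mathbf q_{\mathrm{in}},\boldsymbol\xi_{\mathrm{in}}\rangle=0$; (C4) $\big\langle\mathbf c_1+\int_{\mathcal S_2^*}\mathbf Q^{\mathsf T}\boldsymbol\lambda\,\tau(\mathrm d\boldsymbol\lambda)-\mathbf L_{\mathrm{in}}^{\mathsf T}\boldsymbol\xi_{\mathrm{in}}-\mathbf L_{\mathrm{eq}}^{\mathsf T}\boldsymbol\xi_{\mathrm{eq}},\boldsymbol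 x\big\rangle=0$; and for $i=1,\dots,d$: (C5) $-\int_{\Omega_i}\sup_{z\in\mathbb R}\{z\omega-f_i(z)\}\,\mu_i(\mathrm d\omega)-\int_{\mathbb R}f_i\,\mathrm d(\langle\mathbf p_i,\cdot\rangle\sharp\tau)\ge\mathrm{OT}_{\mu_i}(\langle\mathbf p_i,\cdot\rangle\sharp\tau)-\varepsilon_{\mathrm{OT}}$; (C6) $\partial f_i(z)\subseteq\Omega_i$ for all $z\in\mathbb R$. Let $\varepsilon_{\mathrm{vio}}:=\sup_{\boldsymbol\lambda\in\mathcal S_2^*}\big\{\langle\mathbf Q\boldsymbol x+\mathbf b,\boldsymbol\lambda\rangle+\sum_{i=1}^d f_i(\langle\mathbf p_i,\boldsymbol\lambda\rangle)\big\}$ and $\varepsilon_{\mathrm{sub}}:=\varepsilon_{\mathrm{vio}}+d\,\varepsilon_{\mathrm{OT}}$. (i) Then $(\boldsymbol x,f_1-\varepsilon_{\mathrm{vio}},f_2,\dots,f_d)$ is an $\varepsilon_{\mathrm{sub}}$-optimizer of (Primal), and $\boldsymbol x$ is an $\varepsilon_{\mathrm{sub}}$-optimizer of (DRO). In the following, let $K:=|\mathcal V|$, enumerate $\mathcal V=\{\boldsymbol\lambda_1,\dots,\boldsymbol\lambda_K\}$, and for $i=1,\dots,d$ let $\sigma_i:\{1,\dots,K\}\to\{1,\dots,K\}$ be a permutation satisfying $\langle\mathbf p_i,\boldsymbol\lambda_{\sigma_i(1)}\rangle\le\langle\mathbf p_i,\boldsymbol\lambda_{\sigma_i(2)}\rangle\le\cdots\le\langle\mathbf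 p_i,\boldsymbol\lambda_{\sigma_i(K)}\rangle$. Let $(\mathscr X,\mathscr F,\mathbb P)$ be a probability space, and let $J:\mathscr X\to\{1,\dots,K\}$ be a random variable satisfying $\mathbb P[J=j]=\tau(\{\boldsymbol\lambda_j\})$ for $j=1,\dots,K$. Let $(U_1,\dots,U_d)^{\mathsf T}:\mathscr X\to[0,1]^d$ be a random variable that is independent of $J$ and such that each of $U_1,\dots,U_d$ is uniformly distributed on $[0,1]$. For $i=1,\dots,d$ let $G^-_{\mu_i}:[0,1]\to\Omega_i$, $G^-_{\mu_i}(u):=\inf\{t\in\Omega_i:\mu_i([\underline\omega_i,t])\ge u\}$, and let $Y_i:\mathscr X\to\Omega_i$ be the random variable $$Y_i:=G^-_{\mu_i}\Big(U_i\,\tau(\{\boldsymbol\lambda_J\})+\sum_{j=1}^{\sigma_i^{-1}(J)-1}\tau(\{\boldsymbol\lambda_{\sigma_i(j)}\})\Big).$$ Let $\mu_\tau\in\mathcal P(\boldsymbol\Omega)$ denote the law of $(Y_1,\dots,Y_d)^{\mathsf T}:\mathscr X\to\boldsymbol\Omega$. (ii) Then $\mu_\tau$ is an $\varepsilon_{\mathrm{sub}}$-optimizer of the inner maximization problem in (DRO) with respect to $\boldsymbol x$, i.e., of $\sup_{\mu\in\Gamma(\mu_1,\dots,\mu_d)}\int_{\boldsymbol\Omega}C_2(\boldsymbol x,\boldsymbol\omega)\,\mu(\mathrm d\boldsymbol\omega)$.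
   Context: Notation. $\mathbb N_0=\mathbb N\cup\{0\}$, $\mathbb R_+=[0,\infty)$, $\mathbb R_-=(-\infty,0]$; vector inequalities are componentwise; $\langle\cdot,\cdot\rangle$ is the Euclidean inner product. For closed $\mathcal Y\subseteq\mathbb R^n$, $\mathcal P(\mathcal Y)$ is the set of Borel probability measures on $\mathcal Y$ and $\mathcal P_1(\mathcal Y)$ the subset of those with finite first moment; $\mathrm{supp}$ denotes the support, $g\sharp\mu$ the pushforward of $\mu$ by $g$. $\mathcal C_{\mathrm{cvx}}(\mathbb R)$ is the set of continuous convex functions $\mathbb R\to\mathbb R$, and $\partial f(z)$ is the convex subdifferential. An $\varepsilon$-optimizer is a feasible point whose objective is within $\varepsilon$ of the optimal value. Setting. Let $d\ge 2$ be an integer, $\Omega_i=[\underline\omega_i,\overline\omega_i]$ with $-\infty<\underline\omega_i\le\overline\omega_i<\infty$, $\mu_i\in\mathcal P(\Omega_i)$ ($i=1,\dots,d$), and $\boldsymbol\Omega=\Omega_1\times\cdots\times\Omega_d$. $\Gamma(\mu_1,\dots,\mu_d)$ is the set of $\gamma\in\mathcal P(\boldsymbol\Omega)$ whose marginal on $\Omega_i$ is $\mu_i$ for every $i$. Let $k_1\in\mathbb N$, $\mathbf c_1\in\mathbb R^{k_1}$, $n_{\mathrm{in}},n_{\mathrm{eq}}\in\mathbb N_0$, $\mathbf L_{\mathrm{in}}\in\mathbb R^{n_{\mathrm{in}}\times k_1}$, $\mathbf q_{\mathrm{in}}\in\mathbb R^{n_{\mathrm{in}}}$, $\mathbf L_{\mathrm{eq}}\in\mathbb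 R^{n_{\mathrm{eq}}\times k_1}$, $\mathbf q_{\mathrm{eq}}\in\mathbb R^{n_{\mathrm{eq}}}$, and assume that $\mathcal S_1:=\{\boldsymbol x\in\mathbb R_+^{k_1}:\mathbf L_{\mathrm{in}}\boldsymbol x\le\mathbf q_{\mathrm{in}},\ \mathbf L_{\mathrm{eq}}\boldsymbol x=\mathbf q_{\mathrm{eq}}\}$ is non-empty. Let $k_2^*\in\mathbb N$, $\mathbf Q\in\mathbb R^{k_2^*\times k_1}$, $\mathbf P\in\mathbb R^{k_2^*\times d}$ with $i$-th column $\mathbf p_i\in\mathbb R^{k_2^*}$, $\mathbf b\in\mathbb R^{k_2^*}$. Let $m_{\mathrm{in}},m_{\mathrm{eq}}\in\mathbb N_0$ with $m_{\mathrm{in}}+m_{\mathrm{eq}}=k_2^*$, $k_2\in\mathbb N$, $\mathbf A_{\mathrm{in}}\in\mathbb R^{m_{\mathrm{in}}\times k_2}$, $\mathbf A_{\mathrm{eq}}\in\mathbb R^{m_{\mathrm{eq}}\times k_2}$, $\mathbf c_2\in\mathbb R^{k_2}$, and assume that $\mathcal S_2^*:=\{(\boldsymbol\lambda_{\mathrm{in}}^{\mathsf T},\boldsymbol\lambda_{\mathrm{eq}}^{\mathsf T})^{\mathsf T}:\boldsymbol\lambda_{\mathrm{in}}\in\mathbb R_-^{m_{\mathrm{in}}},\ \boldsymbol\lambda_{\mathrm{eq}}\in\mathbb R^{m_{\mathrm{eq}}},\ \mathbf A_{\mathrm{in}}^{\mathsf T}\boldsymbol\lambda_{\mathrm{in}}+\mathbf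 A_{\mathrm{eq}}^{\mathsf T}\boldsymbol\lambda_{\mathrm{eq}}\le\mathbf c_2\}\subset\mathbb R^{k_2^*}$ is non-empty. The optimal second-stage cost is $C_2(\boldsymbol x,\boldsymbol\omega):=\max_{\boldsymbol\lambda\in\mathcal S_2^*}\langle\mathbf Q\boldsymbol x+\mathbf P\boldsymbol\omega+\mathbf b,\boldsymbol\lambda\rangle$ for $\boldsymbol x\in\mathcal S_1$, $\boldsymbol\omega\in\boldsymbol\Omega$, and it is assumed that $\sup_{\boldsymbol x\in\mathcal S_1,\boldsymbol\omega\in\boldsymbol\Omega}C_2(\boldsymbol x,\boldsymbol\omega)<\infty$. Problem (DRO): minimize over $\boldsymbol x\in\mathcal S_1$ the function $\langle\mathbf c_1,\boldsymbol x\rangle+\sup_{\mu\in\Gamma(\mu_1,\dots,\mu_d)}\int_{\boldsymbol\Omega}C_2(\boldsymbol x,\boldsymbol\omega)\,\mu(\mathrm d\boldsymbol\omega)$; its optimal value is $C_{\mathrm{DRO}}$. For $\nu\in\mathcal P_1(\mathbb R)$, $\mathrm{OT}_{\mu_i}(\nu):=\inf_{\gamma\in\Gamma(\mu_i,\nu)}\int_{\Omega_i\times\mathbb R}-z\omega\,\gamma(\mathrm d\omega,\mathrm dz)$, where $\Gamma(\mu_i,\nu)$ is the set of couplings of $\mu_i$ and $\nu$. $\langle\mathbf p_i,\cdot\rangle$ denotes the map $\boldsymbol\lambda\mapsto\langle\mathbf p_i,\boldsymbol\lambda\rangle$. Problem (Primal): minimize $\langle \mathbf c_1,\boldsymbol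 x\rangle+\sum_{i=1}^d\int_{\Omega_i}\sup_{z\in\mathbb R}\{z\omega-f_i(z)\}\,\mu_i(\mathrm d\omega)$ over $\boldsymbol x\in\mathbb R_+^{k_1}$, $f_1,\dots,f_d\in\mathcal C_{\mathrm{cvx}}(\mathbb R)$ subject to $\mathbf L_{\mathrm{in}}\boldsymbol x\le \mathbf q_{\mathrm{in}}$, $\mathbf L_{\mathrm{eq}}\boldsymbol x=\mathbf q_{\mathrm{eq}}$, and $\langle \mathbf Q\boldsymbol x+\mathbf b,\boldsymbol\lambda\rangle+\sum_{i=1}^d f_i(\langle\mathbf p_i,\boldsymbol\lambda\rangle)\le 0$ for all $\boldsymbol\lambda\in\mathcal S_2^*$. Problem (Dual): maximize $\int_{\mathcal S_2^*}\langle\mathbf b,\boldsymbol\lambda\rangle\,\tau(\mathrm d\boldsymbol\lambda)-\big(\sum_{i=1}^d \mathrm{OT}_{\mu_i}(\langle\mathbf p_i,\cdot\rangle\sharp\tau)\big)+\langle\mathbf q_{\mathrm{in}},\boldsymbol\xi_{\mathrm{in}}\rangle+\langle\mathbf q_{\mathrm{eq}},\boldsymbol\xi_{\mathrm{eq}}\rangle$ over $\tau\in\mathcal P_1(\mathcal S_2^* )$, $\boldsymbol\xi_{\mathrm{in}}\in\mathbb R_-^{n_{\mathrm{in}}}$, $\boldsymbol\xi_{\mathrm{eq}}\in\mathbb R^{n_{\mathrm{eq}}}$ subject to $\mathbf c_1+\int_{\mathcal S_2^*}\mathbf Q^{\mathsf T}\boldsymbol\lambda\,\tau(\mathrm d\boldsymbol\lambda)\ge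 \mathbf L_{\mathrm{in}}^{\mathsf T}\boldsymbol\xi_{\mathrm{in}}+\mathbf L_{\mathrm{eq}}^{\mathsf T}\boldsymbol\xi_{\mathrm{eq}}$. *)

(* Defs.v *)
From HB Require Import structures.
From mathcomp Require Import all_boot all_order all_algebra perm.
From mathcomp Require Import all_classical all_reals all_analysis.
From mathcomp Require Import measurable_realfun.

Set Implicit Arguments.
Unset Strict Implicit.
Unset Printing Implicit Defensive.

Import Order.TTheory GRing.Theory Num.Theory.
Import numFieldNormedType.Exports.

Local Open Scope classical_set_scope.
Local Open Scope ring_scope.

(* R^n with its Borel sigma-algebra; convertible to 'cV[R]_n. *)
Definition vborel (R : realType) (n : nat) : measurableType _ :=
  g_sigma_algebraType (@open 'cV[R]_n).

(* A Borel probability measure on a closed set Y is represented by a Borel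
   probability measure on the ambient space giving mass 1 to Y. *)

Section Vectors.
Context {R : realType}.

Definition dotv {n} (u v : 'cV[R]_n) : R := \sum_j u j 0 * v j 0.

Definition lev {n} (u v : 'cV[R]_n) : Prop := forall j, u j 0 <= v j 0.

Lemma continuous_dotv {n} (u : 'cV[R]_n) : continuous (dotv u).
Proof.
suff h (s : seq 'I_n) :
  continuous (fun v : 'cV[R]_n => \sum_(j <- s) u j 0 * v j 0 : R) by exact: h.
elim: s => [|j s ih].
  by under eq_fun do rewrite big_nil; exact: cst_continuous.
under eq_fun do rewrite big_cons.
move=> v; apply: continuousD (ih v).
by apply: continuousM; [exact: cst_continuous|exact: coord_continuous].
Qed.

Lemma measurable_dotv {n} (u : 'cV[R]_n) :
  measurable_fun setT (dotv u : vborel R n -> measurableTypeR R).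
Proof.
apply: (measurability _ (RGenOpens.measurableE R)).
move=> _ [_ [a [b ->]] <-]; rewrite setTI; apply: sub_sigma_algebra.
apply: open_comp; first by move=> x _; exact: continuous_dotv.
exact: interval_open.
Qed.

Definition bdotv {n} (p : 'cV[R]_n) (v : vborel R n) : measurableTypeR R :=
  dotv p v.

HB.instance Definition _ n (p : 'cV[R]_n) :=
  isMeasurableFun.Build _ _ (vborel R n) (measurableTypeR R) (bdotv p)
    (measurable_dotv p).

Definition law_dotv {n} (p : 'cV[R]_n) (tau : probability (vborel R n) R) :
    probability (measurableTypeR R) R :=
  distribution tau (bdotv p).

Definition supp {n} (tau : probability (vborel R n) R) : set 'cV[R]_n :=
  [set v | forall U : set 'cV[R]_n, open U -> U v -> (0 < tau U)%E].

End Vectors.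

Section Optimizers.
Context {R : realType} {T : Type}.
Local Open Scope ereal_scope.

Definition eps_minimizer (F : set T) (obj : T -> \bar R) (eps : R) (x : T) :=
  F x /\ obj x <= ereal_inf (obj @` F) + eps%:E.

Definition eps_maximizer (F : set T) (obj : T -> \bar R) (eps : R) (x : T) :=
  F x /\ ereal_sup (obj @` F) <= obj x + eps%:E.

End Optimizers.

Section ConvexFunctions.
Context {R : realType}.

Definition C_cvx : set (R -> R) :=
  [set f | continuous f /\
    convex_function (setT : set (convex_lmodType R^o)) (f : R^o -> R^o)].

Definition subdiff (f : R -> R) (z : R) : set R :=
  [set s | forall y, f z + s * (y - z) <= f y].

(* sup_z (z w - f z), possibly +oo. *)
Definition conjugate (f : R -> R) (w : R) : \bar R :=
  ereal_sup [set (z * w - f z)%:E | z in [set: R]].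

End ConvexFunctions.

Section OptimalTransport.
Context {R : realType}.

Definition couplings (mu nu : probability (measurableTypeR R) R) :
    set (probability (measurableTypeR R * measurableTypeR R)%type R) :=
  [set gamma : probability (measurableTypeR R * measurableTypeR R)%type R |
     forall A : set (measurableTypeR R), measurable A ->
     gamma (A `*` setT) = mu A /\ gamma (setT `*` A) = nu A].

(* mu is carried by the interval [a, b]. *)
Definition OT (a b : R) (mu nu : probability (measurableTypeR R) R) : \bar R :=
  ereal_inf [set (\int[gamma]_(q in `[a, b]%classic `*` setT)
                    (- (q.2 * q.1))%:E)%E | gamma in couplings mu nu].

(* The left-continuous generalized inverse G^-_mu of the distribution function
   of mu, taken within [a, b]. *)
Definition quantile (a b : R) (mu : probability (measurableTypeR R) R) (u : R) :
    R :=
  inf [set t | t \in `[a, b] /\ (u%:E <= mu `[a, t]%classic)%E].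

End OptimalTransport.

(* The second-stage dual variable lives in R^(m_in + m_eq), i.e. k_2^* is
   m_in + m_eq. *)
Record dro_data (R : realType) (d k1 n_in n_eq m_in m_eq k2 : nat) := DROData {
  omega_lo : 'I_d -> R;
  omega_hi : 'I_d -> R;
  marg : 'I_d -> probability (measurableTypeR R) R;
  c1 : 'cV[R]_k1;
  L_in : 'M[R]_(n_in, k1);
  q_in : 'cV[R]_n_in;
  L_eq : 'M[R]_(n_eq, k1);
  q_eq : 'cV[R]_n_eq;
  Q : 'M[R]_(m_in + m_eq, k1);
  P : 'M[R]_(m_in + m_eq, d);
  b : 'cV[R]_(m_in + m_eq);
  A_in : 'M[R]_(m_in, k2);
  A_eq : 'M[R]_(m_eq, k2);
  c2 : 'cV[R]_k2
}.

Section Problem.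
Context {R : realType} {d k1 n_in n_eq m_in m_eq k2 : nat}.
Variable D : dro_data R d k1 n_in n_eq m_in m_eq k2.

Definition Omega_ (i : 'I_d) : set R :=
  `[omega_lo D i, omega_hi D i]%classic.

Definition Omega : set 'cV[R]_d := [set w | forall i, Omega_ i (w i 0)].

Definition p_ (i : 'I_d) : 'cV[R]_(m_in + m_eq) := col i (P D).

Definition S1 : set 'cV[R]_k1 :=
  [set x | [/\ lev 0 x, lev (L_in D *m x) (q_in D) & L_eq D *m x = q_eq D]].

Definition S2star : set 'cV[R]_(m_in + m_eq) :=
  [set l | lev (usubmx l) 0 /\
     lev ((A_in D)^T *m usubmx l + (A_eq D)^T *m dsubmx l) (c2 D)].

(* In the setting below the supremum is finite for x in S1 and w in Omega, hence
   attained, being the value of a feasible and bounded linear program. *)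
Definition C2 (x : 'cV[R]_k1) (w : 'cV[R]_d) : \bar R :=
  ereal_sup [set (dotv (Q D *m x + P D *m w + b D) l)%:E | l in S2star].

Record dro_setting : Prop := DROSetting {
  d_ge2 : (2 <= d)%N;
  k1_gt0 : (0 < k1)%N;
  k2star_gt0 : (0 < m_in + m_eq)%N;
  k2_gt0 : (0 < k2)%N;
  omega_le : forall i, omega_lo D i <= omega_hi D i;
  marg_Omega : forall i, marg D i (Omega_ i) = 1%E;
  S1_nonempty : S1 !=set0;
  S2star_nonempty : S2star !=set0;
  C2_bounded : (ereal_sup [set C2 x w | x in S1 & w in Omega] < +oo)%E
}.

Definition Gamma : set (probability (vborel R d) R) :=
  [set mu : probability (vborel R d) R | mu Omega = 1%E /\
     forall i (A : set (measurableTypeR R)), measurable A ->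
       mu [set w : 'cV[R]_d | A (w i 0)] = marg D i A].

Definition inner_obj (x : 'cV[R]_k1) (mu : probability (vborel R d) R) :
    \bar R :=
  (\int[mu]_(w in Omega) C2 x w)%E.

Definition dro_obj (x : 'cV[R]_k1) : \bar R :=
  ((dotv (c1 D) x)%:E + ereal_sup (inner_obj x @` Gamma))%E.

Definition C_DRO : \bar R := ereal_inf (dro_obj @` S1).

(* The left-hand side of the semi-infinite constraint of the primal problem. *)
Definition slack (x : 'cV[R]_k1) (f : 'I_d -> R -> R)
    (l : 'cV[R]_(m_in + m_eq)) : R :=
  dotv (Q D *m x + b D) l + \sum_i f i (dotv (p_ i) l).

Definition primal_feasible : set ('cV[R]_k1 * ('I_d -> R -> R)) :=
  [set xf | [/\ S1 xf.1, forall i, C_cvx (xf.2 i) &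
     forall l, S2star l -> slack xf.1 xf.2 l <= 0]].

Definition primal_obj (xf : 'cV[R]_k1 * ('I_d -> R -> R)) : \bar R :=
  ((dotv (c1 D) xf.1)%:E +
   \sum_i \int[marg D i]_(w in Omega_ i) conjugate (xf.2 i) w)%E.

Definition QTmean (tau : probability (vborel R (m_in + m_eq)) R) : 'cV[R]_k1 :=
  \col_j Rintegral tau S2star (fun l => ((Q D)^T *m l) j 0).

(* The first moment is taken for the max norm on R^n; all norms on R^n give the
   same condition. *)
Definition dual_feasible (tau : probability (vborel R (m_in + m_eq)) R)
    (xi_in : 'cV[R]_n_in) (xi_eq : 'cV[R]_n_eq) : Prop :=
  [/\ tau S2star = 1%E,
      (\int[tau]_(l in S2star) (`|l : 'cV[R]_(m_in + m_eq)|)%:E < +oo)%E,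
      lev xi_in 0 &
      lev ((L_in D)^T *m xi_in + (L_eq D)^T *m xi_eq) (c1 D + QTmean tau)].

(* The set is bounded above as soon as every subdifferential of f i lies in
   Omega_ i and x is in S1, so the real-valued supremum is a genuine one. *)
Definition eps_vio (x : 'cV[R]_k1) (f : 'I_d -> R -> R) : R :=
  sup [set slack x f l | l in S2star].

Definition shift_first (f : 'I_d -> R -> R) (e : R) : 'I_d -> R -> R :=
  fun i z => if val i == 0%N then f i z - e else f i z.

(* The vector (Y_1, ..., Y_d); indices 1..K become 0..K-1, so that the ranks
   1, ..., sigma_i^-1(J) - 1 become the j < sigma_i^-1(J). *)
Definition Yvec {X : Type} {K : nat}
    (tau : probability (vborel R (m_in + m_eq)) R)
    (lam : 'I_K -> 'cV[R]_(m_in + m_eq)) (sigma : 'I_d -> {perm 'I_K})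
    (J : X -> 'I_K) (U : X -> 'cV[R]_d) (w : X) : 'cV[R]_d :=
  \col_i quantile (omega_lo D i) (omega_hi D i) (marg D i)
    (U w i 0 * fine (tau [set lam (J w)]) +
     \sum_(j < K | (j < (sigma i)^-1%g (J w))%N)
        fine (tau [set lam (sigma i j)])).

End Problem.

(* Main.v *)
Require Import Defs.
From mathcomp Require Import all_boot all_order all_algebra perm.
From mathcomp Require Import all_classical all_reals all_analysis.
From mathcomp Require Import measurable_realfun.
From mathcomp Require Import ring lra.

(** Everything is compared with one real number, the value taken by the dual
    objective when each optimal transport cost is replaced by that of an explicit
    coupling.

    Take random variables J and Y as in the second part: J picks an atom of tau,
    and Y_i is the quantile function of the marginal i evaluated at a uniform level
    drawn in the interval of length tau (lam_J) attached to the atom, the intervals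
    being stacked in increasing order of <p_i, lam>. The levels are uniform on
    [0, 1] (spread_cdf), so Y_i has the right law (spread_quantile_law), and Y_i is
    comonotone with <p_i, lam_J>. A comonotone pair is an optimal coupling: for the
    finitely many values of <p_i, lam> there are piecewise linear potentials that
    dominate the product z w everywhere and equal it along the coupling (pot_ge,
    pot_eq). Hence OT_i is at least - E[<p_i, lam_J> Y_i] (OT_ge_spread).

    Lower bounds. The law of Y belongs to Gamma, and C2 (x', Y) is at least the
    value at lam_J of the linear form that it maximizes, for every x' in S1
    (coupling_inner_obj). Together with weak duality in the first stage, this bounds
    the robust objective from below by the reference value (dro_obj_ge). Young's
    inequality z w <= f z + f^* w shows that the primal objective dominates the
    robust one (inner_obj_le, primal_obj_ge), so it has the same lower bound.

    Upper bounds. The hypothesis hC5 with the lower bound on OT_i bounds the integral of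
    each conjugate (conjugate_integral_le). Summing over i, the integrals of the f_i
    cancel against the linear term because the slack vanishes on the support (hC1),
    and complementary slackness (hC3, hC4) gives the first-stage value. The objectives
    at x are thus within eps_vio + d eps_OT of the reference value (objective_le).
    The supremum eps_vio is finite because the slopes of the f_i lie in the bounded
    sets Omega_i (hC6), which bounds the slack by second-stage costs
    (slack_le_eps_vio).

    For the first part, a space carrying such a J and Y has to be built: the product
    of tau with the uniform law. A finitely supported tau is concentrated on its
    support since R^n has a countable base (supp_full). *)

Set Implicit Arguments.
Unset Strict Implicit.
Unset Printing Implicit Defensive.

Import Order.TTheory GRing.Theory Num.Theory.
Import numFieldNormedType.Exports.
Local Open Scope classical_set_scope.
Local Open Scope ring_scope.

(** * Borel sets of R^n *)

Lemma natSinv_lt (R : archiRealFieldType) (e : R) : 0 < e ->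
  exists k : nat, k.+1%:R^-1 < e.
Proof.
move=> e0; have [k _ /(_ k (leqnn k)) /= ke] :=
  near_infty_natSinv_lt (PosNum e0).
by exists k.
Qed.

Section BorelVectors.
Context {R : realType}.

Lemma measurable_continuous_vborel n (g : 'cV[R]_n -> R) : continuous g ->
  measurable_fun setT (g : vborel R n -> measurableTypeR R).
Proof.
move=> cg; apply: (measurability _ (RGenOpens.measurableE R)).
move=> _ [_ [a [b ->]] <-]; rewrite setTI; apply: sub_sigma_algebra.
by apply: open_comp; [move=> x _; exact: cg|exact: interval_open].
Qed.

Lemma measurable_coord n (i : 'I_n) :
  measurable_fun setT
    ((fun v : 'cV[R]_n => v i 0) : vborel R n -> measurableTypeR R).
Proof.
by apply: measurable_continuous_vborel => v; exact: coord_continuous.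
Qed.

(** The open boxes with rational centre and rational size, indexed by nat through
    a coding of the pairs (centre, k), so that a union of boxes is a countable
    union; an index that codes no pair gives the empty set. *)
Definition rbox n (m : nat) : set 'cV[R]_n :=
  [set v | oapp (fun qk : 'cV[rat]_n * nat =>
    forall i, `|ratr (qk.1 i 0) - v i 0| < qk.2.+1%:R^-1) False (unpickle m)].

Lemma forall_fin_measurable d (T : measurableType d) (I : finType)
    (F : I -> set T) :
  (forall i, measurable (F i)) -> measurable [set x | forall i, F i x].
Proof.
move=> mF; rewrite [X in measurable X](_ : _ = \bigcap_(i in [set: I]) F i).
  by apply: fin_bigcap_measurable => // i _; exact: mF.
by apply/seteqP; split=> x /= h i; [move=> _|]; apply: h.
Qed.

Lemma measurable_rbox_preimage d (X : measurableType d) n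
    (g : X -> 'cV[R]_n) m :
  (forall i, measurable_fun setT
     ((fun x => g x i 0) : X -> measurableTypeR R)) ->
  measurable (g @^-1` @rbox n m).
Proof.
move=> mg; rewrite /rbox /preimage/=; case: (unpickle m) => [[q k]|];
  last exact: measurable0.
apply: forall_fin_measurable => i.
have := mg i measurableT
  `](ratr (q i 0) - k.+1%:R^-1), (ratr (q i 0) + k.+1%:R^-1)[%classic
  (measurable_itv _).
rewrite setTI; congr measurable; apply/seteqP; split => x /=;
  by rewrite in_itv/= ltr_distlC.
Qed.

(** If [U] contains the ball of radius [e] around [v], any box of half-width less
    than [e / 2] whose centre is within [e / 2] of [v] fits in it. *)
Lemma rbox_base n (U : set 'cV[R]_n) v : open U -> U v ->
  exists m, rbox m v /\ @rbox n m `<=` U.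
Proof.
move=> oU Uv; have : nbhs v U by exact: open_nbhs_nbhs.
rewrite nbhs_ballP => -[e /= e0 eU].
have [k ke] : exists k : nat, k.+1%:R^-1 < e / 2.
  by apply: natSinv_lt; rewrite divr_gt0.
have qP i : exists q : rat, `|ratr q - v i 0| < k.+1%:R^-1.
  have h : v i 0 - k.+1%:R^-1 < v i 0 + k.+1%:R^-1.
    by rewrite ltrBlDr -addrA ltrDl addr_gt0// invr_gt0.
  have [q] := rat_in_itvoo h.
  by rewrite in_itv/= -ltr_distlC distrC; exists q.
have [q hq] := choice qP.
exists (pickle (\col_i q i, k)); rewrite /rbox pickleK /=.
split=> [i|w hw]; first by rewrite mxE.
apply: eU; split => // i j; rewrite (ord1 j) /ball/=.
apply: le_lt_trans (ler_distD (ratr (q i)) _ _) _.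
rewrite [ltRHS](splitr e); apply: ltrD; apply: lt_trans ke.
  by rewrite distrC.
by have := hw i; rewrite mxE.
Qed.

(** Every open set is a countable union of rational boxes, so coordinatewise
    measurability is enough. *)
Lemma measurable_fun_vborel d (X : measurableType d) n (g : X -> 'cV[R]_n) :
  (forall i, measurable_fun setT
     ((fun x => g x i 0) : X -> measurableTypeR R)) ->
  measurable_fun setT (g : X -> vborel R n).
Proof.
move=> mg; apply: (@measurability _ _ X (vborel R n) setT g (@open 'cV[R]_n)
  erefl).
move=> _ [U oU <-]; rewrite setTI.
rewrite [X in measurable X](_ : _ =
    \bigcup_(m in [set m | @rbox n m `<=` U]) g @^-1` (rbox m)).
  by apply: bigcup_measurable => m _; exact: measurable_rbox_preimage.
apply/seteqP; split=> [x /= Ux|x [m /= mU]]; last exact: mU.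
by have [m [mx mU]] := rbox_base oU Ux; exists m.
Qed.

Lemma measurable_vborel_set1 n (v : 'cV[R]_n) :
  measurable ([set v] : set (vborel R n)).
Proof.
rewrite [X in measurable X](_ : _ = [set w : vborel R n | forall i,
    ((fun w : 'cV[R]_n => w i 0) @^-1` [set v i 0]) w]).
  apply: forall_fin_measurable => i.
  by rewrite -[X in measurable X]setTI; exact: measurable_coord.
apply/seteqP; split=> [w -> //|w /= h].
by apply/matrixP => i j; rewrite (ord1 j); exact: h.
Qed.

(** The complement of the support is covered by the countably many null
    rational boxes. *)
Lemma supp_full n (tau : probability (vborel R n) R) (V : set (vborel R n)) :
  supp tau `<=` V -> measurable V -> tau V = 1%E.
Proof.
move=> sV mV.
have mrb m : measurable (@rbox n m : set (vborel R n)).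
  rewrite -[X in measurable X]preimage_id.
  apply: (@measurable_rbox_preimage _ (vborel R n)) => i.
  exact: measurable_coord.
suff V0 : tau.-negligible (~` V).
  have : tau (~` V) = 0%E.
    by apply: measure_negligible => //; exact: measurableC.
  by rewrite probability_setC// => /eqP; rewrite sube_eq// add0e => /eqP.
pose F m := if tau (@rbox n m) == 0%E then @rbox n m else set0.
apply: (@negligibleS _ _ _ tau (\bigcup_m F m)); last first.
  apply: negligible_bigcup => m; rewrite /F; case: ifPn => [/eqP m0|_].
    exact/negligibleP.
  exact: negligible_set0.
move=> v Vv; have : ~ supp tau v by move=> /sV.
rewrite /supp/= => /existsNP[U] /not_implyP[oU] /not_implyP[Uv] /negP.
rewrite -leNgt => U0.
have [m [mv mU]] := rbox_base oU Uv; exists m => //.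
rewrite /F ifT//; rewrite eq_le measure_ge0 andbT (le_trans _ U0)//.
by apply: le_measure => //; rewrite inE//; exact: sub_sigma_algebra.
Qed.

End BorelVectors.

(** * Integration against a probability measure *)

Section ProbabilityIntegrals.
Context {d} {T : measurableType d} {R : realType}.
Implicit Type P : probability T R.

(** Positive and negative parts are compared separately, so that integrals with
    infinite value are allowed. *)
Lemma le_integral_measurable (mu : {measure set T -> \bar R}) (D : set T)
    (f g : T -> \bar R) : measurable D ->
  measurable_fun D f -> measurable_fun D g ->
  (forall x, D x -> (f x <= g x)%E) ->
  (\int[mu]_(x in D) f x <= \int[mu]_(x in D) g x)%E.
Proof.
move=> mD mf mg fg; rewrite integralE [leRHS]integralE leeB//.
- apply: ge0_le_integral => //; try exact: measurable_funepos.
  move=> x Dx; apply: (@funepos_le _ _ D) => //; last exact/mem_set.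
  by move=> y /set_mem; exact: fg.
- apply: ge0_le_integral => //; try exact: measurable_funeneg.
  move=> x Dx; apply: (@funeneg_le _ _ D) => //; last exact/mem_set.
  by move=> y /set_mem; exact: fg.
Qed.

Lemma probability_negligibleC P (A : set T) : measurable A -> P A = 1%E ->
  P.-negligible (~` A).
Proof.
move=> mA PA; have PC : P (~` A) = 0%E by rewrite probability_setC// PA subee.
by apply/negligibleP => //; exact: measurableC.
Qed.

Lemma integral_full P (A D : set T) (f : T -> \bar R) :
  measurable A -> measurable D -> A `<=` D -> P A = 1%E ->
  measurable_fun D f -> (\int[P]_(x in D) f x = \int[P]_(x in A) f x)%E.
Proof.
move=> mA mD AD PA mf; rewrite -[in RHS](setIidr AD) integral_mkcondr.
apply: ae_eq_integral => //.
  apply/(measurable_restrict _ mA mD).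
  by apply: measurable_funS mf => //; exact: subIsetl.
apply: (@negligibleS _ _ _ P (~` A)); last exact: probability_negligibleC.
move=> x /= h Ax; apply: h => _.
by rewrite patchE (mem_set Ax).
Qed.

(** Positive and negative parts are transferred separately, so that integrals
    with infinite value are allowed. *)
Lemma integral_law d' (Y : measurableType d') (phi : T -> Y)
    (mu : {measure set T -> \bar R}) (nu : {measure set Y -> \bar R})
    (D : set Y) (f : Y -> \bar R) :
  measurable_fun setT phi ->
  (forall A, measurable A -> mu (phi @^-1` A) = nu A) ->
  measurable D -> measurable_fun setT f ->
  (\int[nu]_(y in D) f y = \int[mu]_(x in phi @^-1` D) f (phi x))%E.
Proof.
move=> mphi phiE mD mf; rewrite [LHS]integralE [RHS]integralE.
pose phim : {mfun T >-> Y} := MeasurableFun.Pack (MeasurableFun.Class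
  (isMeasurableFun.Build _ _ _ _ phi mphi)).
have h g : measurable_fun setT g -> (forall y, 0 <= g y)%E ->
    (\int[nu]_(y in D) g y = \int[mu]_(x in phi @^-1` D) g (phi x))%E.
  move=> mg g0; rewrite (eq_measure_integral (pushforward mu phim)) =>
    [|A mA _].
    by rewrite ge0_integral_pushforward//; exact: measurable_funTS.
  by apply/esym; exact: phiE.
rewrite !h//; last 2 first.
- exact: measurable_funeneg.
- exact: measurable_funepos.
by congr (_ - _)%E; apply: eq_integral => x _; rewrite ?funeposE ?funenegE.
Qed.

Lemma bounded_integrable P (D : set T) (f : T -> R) (M : R) :
  measurable D -> measurable_fun D f -> (forall x, D x -> `|f x| <= M) ->
  P.-integrable D (EFin \o f).
Proof.
move=> mD mf fM; apply: measurable_bounded_integrable => //.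
  by rewrite (le_lt_trans (probability_le1 P mD))// ltry.
exists M; split; first exact: num_real.
by move=> N MN x Dx; exact: le_trans (fM x Dx) (ltW MN).
Qed.

Lemma integral_simple_sum P (D : set T) n (a : 'I_n -> R) (A : 'I_n -> set T) :
  measurable D -> (forall k, measurable (A k)) -> (forall k, A k `<=` D) ->
  (\int[P]_(x in D) (\sum_k a k * \1_(A k) x)%:E =
   (\sum_k a k * fine (P (A k)))%:E)%E.
Proof.
move=> mD mA AD.
have iA k : P.-integrable D (fun x => (a k)%:E * (\1_(A k) x)%:E)%E.
  apply: integrableZl => //; apply: (@bounded_integrable P D _ 1) => //.
  by move=> x _; rewrite indicE; case: (_ \in _); rewrite ?normr0 ?normr1.
under eq_integral do rewrite -sumEFin.
under eq_integral do under eq_bigr do rewrite EFinM.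
rewrite integral_sum// -sumEFin; apply: eq_bigr => k _.
rewrite integralZl//; last first.
  apply: (@bounded_integrable P D _ 1) => //.
  by move=> x _; rewrite indicE; case: (_ \in _); rewrite ?normr0 ?normr1.
rewrite integral_indic// setIidl// EFinM fineK//.
by rewrite ge0_fin_numE// (le_lt_trans (probability_le1 P (mA k)))// ltry.
Qed.

Section Index.
Context n (J : T -> 'I_n).
Hypothesis mJ : forall B : set 'I_n, measurable (J @^-1` B).

Lemma index_sum (h : 'I_n -> R) x :
  h (J x) = \sum_k h k * \1_(J @^-1` [set k]) x.
Proof.
rewrite (bigD1 (J x))//= big1 => [|k kJ].
  by rewrite indicE mem_set// mulr1 addr0.
by rewrite indicE memNset ?mulr0// => /= e; move: kJ; rewrite e eqxx.
Qed.

Lemma integral_index P (h : 'I_n -> R) :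
  (\int[P]_x (h (J x))%:E = (\sum_k h k * fine (P (J @^-1` [set k])))%:E)%E.
Proof.
by under eq_integral do rewrite index_sum; exact: integral_simple_sum.
Qed.

Lemma measure_index P (A : set T) : measurable A ->
  P A = (\sum_k P (A `&` J @^-1` [set k]))%E.
Proof.
move=> mA; rewrite -(@measure_bigsetU_ord _ _ _ P n xpredT
  (fun k => A `&` J @^-1` [set k])).
- rewrite -(@bigcup_pred _ _ predT); congr (P _).
  by apply/seteqP; split=> [x Ax|x [k _ []//]]; exists (J x).
- by move=> k; exact: measurableI.
- by move=> i j _ _ [x [[_ /= <-] [_ /= <-]]].
Qed.

Lemma measurable_fun_index d' (Y : measurableType d') (g : 'I_n -> T -> Y) :
  (forall k, measurable_fun setT (g k)) ->
  measurable_fun setT (fun x => g (J x) x).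
Proof.
move=> mg _ A mA; rewrite setTI.
rewrite [X in measurable X](_ : _ =
    \bigcup_(k in [set: 'I_n]) (J @^-1` [set k] `&` g k @^-1` A)).
  apply: fin_bigcup_measurable => // k _; apply: measurableI => //.
  by rewrite -[X in measurable X]setTI; exact: mg.
by apply/seteqP; split=> [x /= Ax|x [k _ [/= <-]]//]; exists (J x).
Qed.

End Index.

Section Atoms.
Context (P : probability T R) n (lam : 'I_n -> T).
Hypothesis lamI : injective lam.
Hypothesis mlam : forall k, measurable [set lam k].
Hypothesis Plam : P (range lam) = 1%E.

Lemma measurable_range_atoms : measurable (range lam).
Proof.
rewrite [X in measurable X](_ : _ = \bigcup_(k in [set: 'I_n]) [set lam k]).
  by apply: fin_bigcup_measurable => // k _; exact: mlam.
by apply/seteqP; split=> [_ [k _ <-]|_ [k _ ->]]; exists k.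
Qed.

Lemma integral_atoms (D : set T) (g : T -> R) : measurable D ->
  range lam `<=` D -> measurable_fun D g ->
  (\int[P]_(x in D) (g x)%:E = (\sum_k g (lam k) * fine (P [set lam k]))%:E)%E.
Proof.
move=> mD lamD mg; have mr := measurable_range_atoms.
rewrite (@integral_full _ (range lam) D)//; last exact/measurable_EFinP.
rewrite -(@integral_simple_sum P (range lam) _ _ (fun k => [set lam k]))//.
  apply: eq_integral => _ /set_mem[k _ <-]; congr EFin.
  rewrite (bigD1 k)//= big1 => [|j jk].
    by rewrite indicE mem_set// mulr1 addr0.
  by rewrite indicE memNset ?mulr0//= => /lamI e; move: jk; rewrite e eqxx.
by move=> k _ ->; exists k.
Qed.

Lemma sum_atoms : \sum_k fine (P [set lam k]) = 1.
Proof.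
have := @integral_atoms setT (cst 1) measurableT (@subsetT _ _)
  (measurable_cst _).
rewrite (_ : (\int[P]_x _)%E = 1%E); last first.
  by rewrite -[RHS](probability_setT P) -[RHS]mul1e -integral_cst.
by case=> ->; apply: eq_bigr => k _; rewrite mul1r.
Qed.

End Atoms.

End ProbabilityIntegrals.

Lemma probability_setI_full d (T : measurableType d) (R : realType)
    (P : probability T R) (A D : set T) :
  measurable A -> measurable D -> P D = 1%E -> P A = P (A `&` D).
Proof.
move=> mA mD PD; rewrite (measureDI P mA mD).
rewrite [X in (X + _)%E](_ : _ = 0%E) ?add0e//.
have mAD : measurable (A `\` D) by exact: measurableD.
have mC : measurable (~` D) by exact: measurableC.
have PC : P (~` D) = 0%E by rewrite probability_setC// PD subee.
apply/eqP; rewrite -measure_le0 -PC; apply: le_measure; rewrite ?inE//.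
Qed.

(** * Convex functions of one variable *)

Section Convex.
Context {R : realType}.
Implicit Type f : R -> R.

Lemma C_cvx_le f x y t : C_cvx f -> 0 <= t -> t <= 1 ->
  f (t * x + (1 - t) * y) <= t * f x + (1 - t) * f y.
Proof.
move=> [_ cf] t0 t1.
have := cf (Itv01 t0 t1) x y (in_setT _) (in_setT _).
by rewrite /conv/=.
Qed.

(** The left chord slopes at [z] are bounded by the right ones, and their
    supremum separates the two. *)
Lemma subdiff_nonempty f z : C_cvx f -> exists s, subdiff f z s.
Proof.
move=> cf.
pose L := [set (f z - f y) / (z - y) | y in [set y | y < z]].
have chord y w : y < z -> z < w ->
    (f z - f y) / (z - y) <= (f w - f z) / (w - z).
  move=> yz zw; have zy0 : 0 < z - y by lra.
  have wz0 : 0 < w - z by lra.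
  have wy0 : 0 < w - y by lra.
  rewrite ler_pdivrMr// mulrAC ler_pdivlMr//.
  have t0 : 0 <= (w - z) / (w - y) by rewrite divr_ge0// ltW.
  have t1 : (w - z) / (w - y) <= 1 by rewrite ler_pdivrMr//; lra.
  have := C_cvx_le y w cf t0 t1.
  have -> : (w - z) / (w - y) * y + (1 - (w - z) / (w - y)) * w = z.
    by field; rewrite gt_eqF.
  rewrite -(ler_pM2r wy0).
  have -> : ((w - z) / (w - y) * f y + (1 - (w - z) / (w - y)) * f w) *
      (w - y) = (w - z) * f y + (z - y) * f w.
    by field; rewrite gt_eqF.
  nra.
have L0 : L !=set0.
  exists ((f z - f (z - 1)) / (z - (z - 1))).
  by exists (z - 1) => //=; lra.
have ubL w : z < w -> ubound L ((f w - f z) / (w - z)).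
  by move=> zw _ [y /= yz <-]; exact: chord.
have supL : has_sup L.
  split=> //; exists ((f (z + 1) - f z) / (z + 1 - z)).
  by apply: ubL; lra.
exists (sup L) => y /=; have [yz|zy|->] := ltgtP y z.
- have : (f z - f y) / (z - y) <= sup L.
    by apply: ub_le_sup; [case: supL|exists y].
  rewrite ler_pdivrMr ?subr_gt0//; nra.
- have : sup L <= (f y - f z) / (y - z) by apply: ge_sup => //; exact: ubL.
  rewrite ler_pdivlMr ?subr_gt0//; nra.
- by rewrite subrr mulr0 addr0.
Qed.

Lemma C_cvx_subr f e : C_cvx f -> C_cvx (fun z => f z - e).
Proof.
move=> cf; split.
  move=> z; apply: continuousB; last exact: cst_continuous.
  by case: cf => f1 _; exact: f1.
have key (s X Y : R) : 0 <= s -> s <= 1 ->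
    f (s * X + (1 - s) * Y) - e <= s * (f X - e) + (1 - s) * (f Y - e).
  by move=> s0 s1; have := C_cvx_le X Y cf s0 s1; lra.
by move=> t x y _ _; exact: (key t%:num x y (ge0 t) (le1 t)).
Qed.

Lemma open_gt_sup_continuous (T : topologicalType) (I : Type) (S : set I)
    (g : I -> T -> R) (a : R) : (forall i, continuous (g i)) ->
  open [set w | (a%:E < ereal_sup [set (g i w)%:E | i in S])%E].
Proof.
move=> cg; rewrite [X in open X](_ : _ =
    \bigcup_(i in S) (g i @^-1` [set y | a < y])).
  apply: bigcup_open => i _; apply: open_comp => [x _|]; first exact: cg.
  exact: open_gt.
apply/seteqP; split=> [w /= /ereal_sup_gt [_ [i Si <-]]|w [i Si /= aw]].
  by rewrite lte_fin => aw; exists i.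
have h : (a%:E < (g i w)%:E)%E by rewrite lte_fin.
by apply: lt_le_trans h _; apply: ereal_sup_ubound; exists i.
Qed.

Lemma measurable_conjugate f :
  measurable_fun setT (conjugate f : measurableTypeR R -> \bar R).
Proof.
apply: lower_semicontinuous_measurable; apply/lower_semicontinuousP => a.
apply: (@open_gt_sup_continuous R R setT (fun z w => z * w - f z)) => z w.
apply: continuousB; last exact: cst_continuous.
by apply: continuousM; [exact: cst_continuous|].
Qed.

Lemma conjugate_ge f z w : ((z * w - f z)%:E <= conjugate f w)%E.
Proof. by apply: ereal_sup_ubound; exists z. Qed.

Lemma conjugate_subr f e w :
  (conjugate (fun z => (f z - e)%R) w <= conjugate f w + e%:E)%E.
Proof.
apply: ge_ereal_sup => _ [z _ <-].
rewrite (_ : _ - _ = (z * w - f z) + e); last by rewrite opprB addrA addrAC.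
by rewrite EFinD leeD2r// conjugate_ge.
Qed.

End Convex.

(** * Quantile functions *)

Section Quantile.
Context {R : realType}.
Variables (a b : R) (mu : probability (measurableTypeR R) R).
Hypotheses (ab : a <= b) (mu1 : mu `[a, b]%classic = 1%E).

Let S u := [set t | t \in `[a, b] /\ (u%:E <= mu `[a, t]%classic)%E].

Let S_b u : u <= 1 -> S u b.
Proof. by move=> u1; split; rewrite ?in_itv/= ?ab ?lexx// mu1 lee_fin. Qed.

Let S_inf u : u <= 1 -> has_inf (S u).
Proof.
move=> u1; split; first by exists b; exact: S_b.
by exists a => t [+ _]; rewrite in_itv/= => /andP[].
Qed.

Let subI s t : s <= t -> `[a, s]%classic `<=` `[a, t]%classic.
Proof. by move=> st; apply: subset_itvl; rewrite bnd_simp. Qed.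

Let leI s t : s <= t -> (mu `[a, s]%classic <= mu `[a, t]%classic)%E.
Proof. by move=> st; apply: le_measure; rewrite ?inE//; exact: subI. Qed.

Lemma quantile_itv u : u <= 1 -> quantile a b mu u \in `[a, b].
Proof.
move=> u1; rewrite in_itv/=; apply/andP; split.
  apply: lb_le_inf; first by exists b; exact: S_b.
  by move=> t [+ _]; rewrite in_itv/= => /andP[].
by apply: ge_inf; [case: (S_inf u1)|exact: S_b].
Qed.

(** The distribution function is right continuous, so the infimum is
    attained. *)
Lemma quantile_attained u : u <= 1 ->
  (u%:E <= mu `[a, quantile a b mu u]%classic)%E.
Proof.
move=> u1; set q := quantile a b mu u.
pose F n := `[a, q + n.+1%:R^-1]%classic : set (measurableTypeR R).
have uF n : (u%:E <= mu (F n))%E.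
  have n0 : 0 < n.+1%:R^-1 :> R by rewrite invr_gt0.
  have [t [_ ut] tq] := inf_adherent n0 (S_inf u1).
  by apply: le_trans ut _; apply: leI; exact: ltW.
have capF : \bigcap_n F n = `[a, q]%classic.
  apply/seteqP; split=> [t Ft|t /=].
    have := Ft 0%N I; rewrite /F/= !in_itv/= => /andP[at' _]; rewrite at'/=.
    rewrite leNgt; apply/negP => qt.
    have tq0 : 0 < t - q by rewrite subr_gt0.
    have [n hn] := natSinv_lt tq0.
    have := Ft n I; rewrite /F/= in_itv/= => /andP[_ tn].
    by move: hn; rewrite ltNge lerBlDl tn.
  rewrite in_itv/= => /andP[at' tq] n _; rewrite /F/= in_itv/=.
  by rewrite at' (le_trans tq)// lerDl invr_ge0.
rewrite -capF; have mF n : measurable (F n) by exact: measurable_itv.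
have cF : mu \o F @ \oo --> mu (\bigcap_n F n).
  apply: nonincreasing_cvg_mu => //.
  - by rewrite (le_lt_trans (probability_le1 mu (mF 0%N)))// ltry.
  - by rewrite capF; exact: measurable_itv.
  - move=> m n mn; apply/subsetPset; apply: subI.
    by rewrite lerD2l lef_pV2 ?posrE// ler_nat ltnS.
by apply: cvge_ge cF; apply: nearW.
Qed.

(** The Galois connection between a distribution function and its quantile
    function. *)
Lemma quantile_le u t : u <= 1 -> t \in `[a, b] ->
  (quantile a b mu u <= t) = (u%:E <= mu `[a, t]%classic)%E.
Proof.
move=> u1 tab; apply/idP/idP => [qt|ut].
  apply: le_trans (quantile_attained u1) _.
  exact: leI.
by apply: ge_inf; [case: (S_inf u1)|].
Qed.

Lemma quantile_homo u v : u <= v -> v <= 1 ->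
  quantile a b mu u <= quantile a b mu v.
Proof.
move=> uv v1; rewrite quantile_le ?quantile_itv// ?(le_trans uv)//.
by apply: le_trans (quantile_attained v1); rewrite lee_fin.
Qed.

End Quantile.

(** The half-lines are stable under intersection and generate the Borel sets. *)
Lemma probability_cdf_unique (R : realType)
    (mu nu : probability (measurableTypeR R) R) :
  (forall t, mu `]-oo, t]%classic = nu `]-oo, t]%classic) ->
  forall A, measurable A -> mu A = nu A.
Proof.
move=> h A mA.
apply: (@measure_unique _ R (measurableTypeR R) (@RGenOInfty.G R)
  (fun k => `](- k%:R), +oo[%classic) ) => //.
- exact: RGenOInfty.measurableE.
- move=> _ _ [x ->] [y ->]; exists (Num.max x y).
  apply/seteqP; split=> z /=; rewrite !in_itv/= !andbT gt_max.
    by case=> -> ->.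
  by move=> /andP[].
- by move=> k; exists (- k%:R).
- apply/seteqP; split=> // x _; exists (Num.truncn `|x|).+1 => //=.
  rewrite in_itv/= andbT ltrNl (le_lt_trans (ler_norm _))// normrN.
  exact: truncnS_gt.
- move=> _ [x ->]; rewrite -setCitvl.
  have mx : measurable (`]-oo, x]%classic : set (measurableTypeR R)).
    exact: measurable_itv.
  transitivity (1 - mu `]-oo, x]%classic)%E; first exact: probability_setC.
  by rewrite h; apply/esym; exact: probability_setC.
- by move=> k; rewrite (le_lt_trans (probability_le1 _ _))// ltry.
Qed.

(** * A lower bound on optimal transport *)

(** Weak duality for the cost -z w: integrate the pointwise inequality against a
    coupling. It is required only for [w] in [a, b] and [z] in [Z], which carry
    the marginals, because the potentials below satisfy it only at finitely many
    values of [z], and the first one is unbounded on the line. *)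
Lemma OT_ge (R : realType) (a b : R) (mu nu : probability (measurableTypeR R) R)
    (Z : set (measurableTypeR R)) (phi psi : measurableTypeR R -> R) (M : R) :
  mu `[a, b]%classic = 1%E -> measurable Z -> nu Z = 1%E ->
  measurable_fun setT phi -> measurable_fun setT psi ->
  (forall w, w \in `[a, b] -> `|phi w| <= M) ->
  (forall z, Z z -> `|psi z| <= M) ->
  (forall w z, w \in `[a, b] -> Z z -> z * w <= phi w + psi z) ->
  (- (\int[mu]_(w in `[a, b]) phi w + \int[nu]_(z in Z) psi z)%:E
    <= OT a b mu nu)%E.
Proof.
move=> mu1 mZ nu1 mphi mpsi phiM psiM h.
apply: le_ereal_inf_tmp => _ [g gc <-].
pose I : set (measurableTypeR R) := `[a, b]%classic.
have mI : measurable I by exact: measurable_itv.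
pose D : set (measurableTypeR R * measurableTypeR R) := I `*` setT.
pose D' : set (measurableTypeR R * measurableTypeR R) := I `*` Z.
have mD : measurable D by exact: measurableX.
have mD' : measurable D' by exact: measurableX.
have mTZ : measurable (setT `*` Z : set (measurableTypeR R * measurableTypeR
  R)).
  exact: measurableX.
have D'D : D' `<=` D by move=> q [].
have D'Z : D' `<=` setT `*` Z by move=> q [].
have gD' : g D' = 1%E.
  rewrite (_ : D' = D `&` (setT `*` Z)).
    by rewrite -(probability_setI_full (P := g) mD mTZ) ?(gc _ mI).1//
      (gc _ mZ).2.
  by apply/seteqP; split=> q [] //= [] //= ? ? [].
have mphi1 : measurable_fun setT (fun q : measurableTypeR R * measurableTypeR R
  => phi q.1).
  by apply: measurableT_comp.
have mpsi2 : measurable_fun setT (fun q : measurableTypeR R * measurableTypeR R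
  => psi q.2).
  by apply: measurableT_comp.
have mqq : measurable_fun setT
    (fun q : measurableTypeR R * measurableTypeR R => - (q.2 * q.1)).
  by apply: measurableT_comp => //; apply: measurable_funM.
have Ephi : (\int[g]_(q in D') (phi q.1)%:E = \int[mu]_(w in I) (phi w)%:E)%E.
  rewrite -(integral_full (A := D') (D := D))//;
    last exact/measurable_EFinP/measurable_funTS.
  rewrite [RHS](integral_law (mu := g) (phi := fst))//; last 2 first.
  - move=> A mA; apply: etrans (gc A mA).1; congr (g _).
    by apply/seteqP; split=> q //= [].
  - exact/measurable_EFinP.
  by congr (integral _ _ _); apply/seteqP; split=> q //= [].
have Epsi : (\int[g]_(q in D') (psi q.2)%:E = \int[nu]_(w in Z) (psi w)%:E)%E.
  rewrite -(integral_full (A := D') (D := setT `*` Z))//;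
    last exact/measurable_EFinP/measurable_funTS.
  rewrite [RHS](integral_law (mu := g) (phi := snd))//; last 2 first.
  - move=> A mA; apply: etrans (gc A mA).2; congr (g _).
    by apply/seteqP; split=> q //= [].
  - exact/measurable_EFinP.
  by congr (integral _ _ _); apply/seteqP; split=> q //= [].
have i1 : g.-integrable D' (EFin \o (fun q => phi q.1)).
  apply: (@bounded_integrable _ _ _ g D' _ M) => //;
    first exact: measurable_funTS.
  by move=> q [qI _]; exact: phiM.
have i2 : g.-integrable D' (EFin \o (fun q => psi q.2)).
  apply: (@bounded_integrable _ _ _ g D' _ M) => //;
    first exact: measurable_funTS.
  by move=> q [_ qZ]; exact: psiM.
rewrite (integral_full (A := D') (D := D) (P := g))//;
  last exact/measurable_EFinP/measurable_funTS.
have -> : (- (\int[mu]_(w in `[a, b]) phi w + \int[nu]_(z in Z) psi z)%:E)%E =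
    (\int[g]_(q in D') (- (phi q.1 + psi q.2))%:E)%E.
  have -> : (\int[g]_(q in D') (- (phi q.1 + psi q.2))%:E)%E =
    (\int[g]_(q in D') ((- 1)%R%:E * (phi q.1 + psi q.2)%:E))%E.
    by apply: eq_integral => q _; rewrite -EFinM mulN1r.
  rewrite integralZl//; last exact: (integrableD mD' i1 i2).
  rewrite (integralD_EFin mD' i1 i2)//= /Rintegral -Ephi -Epsi EFinN EFinD
    !fineK ?mulN1e//.
  - exact: (integrable_fin_num mD' i2).
  - exact: (integrable_fin_num mD' i1).
apply: le_integral_measurable => //.
- by apply/measurable_EFinP/measurable_funTS; apply: measurableT_comp => //;
  apply: measurable_funD.
- exact/measurable_EFinP/measurable_funTS.
- by move=> q [qI qZ]; rewrite lee_fin lerN2; exact: h.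
Qed.

Section Potentials.
Context {R : realType} (n : nat) (zz thr : nat -> R).
Hypothesis zz_homo : forall i j, (i <= j)%N -> (j <= n)%N -> zz i <= zz j.
Hypothesis thr_homo : forall i j, (i <= j)%N -> (j <= n)%N -> thr i <= thr j.

(** The couple of potentials attached to the nondecreasing step coupling that
    sends the interval [thr m, thr m.+1] to the point [zz m]: Abel summation of
    [zz m * w] over the increments of [zz], each indicator being dealt with by
    w 1_B <= (w - t)^+ + t 1_B. *)
Definition pot1 (w : R) : R :=
  zz 0 * w + \sum_(j < n) (zz j.+1 - zz j) * Num.max (w - thr j.+1) 0.

Definition pot2 (z : R) : R :=
  \sum_(j < n) (zz j.+1 - zz j) * (thr j.+1 * (zz j.+1 <= z)%R%:R).

Lemma zz_abel m : (m <= n)%N ->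
  zz m = zz 0 + \sum_(j < n) (zz j.+1 - zz j) * (j < m)%N%:R.
Proof.
move=> mn; rewrite -[LHS](subrK (zz 0)) addrC; congr (_ + _).
rewrite -telescope_sumr// big_mkord (big_ord_widen_cond n xpredT (fun j =>
  zz j.+1 - zz j) mn).
by rewrite big_mkcond/=; apply: eq_bigr => j _; case: ltnP;
  rewrite ?mulr1 ?mulr0.
Qed.

(** When [j >= m] but [zz j.+1 <= zz m], the monotonicity of [zz] makes the
    increment vanish: ties contribute nothing. *)
Lemma pot_ge m w : (m <= n)%N -> zz m * w <= pot1 w + pot2 (zz m).
Proof.
move=> mn; rewrite {1}(zz_abel mn) /pot1 /pot2 mulrDl -addrA lerD2l
  -big_split/= mulr_suml.
apply: ler_sum => j _.
have dj : 0 <= zz j.+1 - zz j by rewrite subr_ge0 zz_homo.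
rewrite -mulrDr -mulrA; case: (ltnP j m) => [jm|mj].
  by rewrite zz_homo// mulr1 mul1r ler_wpM2l// -lerBlDr le_max lexx.
have [zz1|] := leP (zz j.+1) (zz m); last first.
  by rewrite mulr0 addr0 mul0r mulr0 mulr_ge0// le_max lexx orbT.
have -> : zz j.+1 - zz j = 0.
  apply/eqP; rewrite eq_le dj andbT subr_le0 (le_trans zz1)// zz_homo//.
  exact: ltnW.
by rewrite !mul0r.
Qed.

(** On the interval sent to [zz m] each w 1_B <= (w - t)^+ + t 1_B is an
    equality: [w] lies above the thresholds up to [m] and below the others. *)
Lemma pot_eq m w : (m <= n)%N -> ((0 < m)%N -> thr m <= w) ->
  ((m < n)%N -> w <= thr m.+1) -> zz m * w = pot1 w + pot2 (zz m).
Proof.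
move=> mn lo hi; rewrite {1}(zz_abel mn) /pot1 /pot2 mulrDl -addrA;
  congr (_ + _).
rewrite -big_split/= mulr_suml; apply: eq_bigr => j _.
rewrite -mulrDr -mulrA; case: (ltnP j m) => [jm|mj].
  have tw : thr j.+1 <= w by apply: le_trans (lo (leq_ltn_trans (leq0n _) jm));
    exact: thr_homo.
  by rewrite zz_homo// mulr1 mul1r max_l ?subr_ge0// subrK.
have wt : w <= thr j.+1.
  by apply: le_trans (hi (leq_ltn_trans mj (ltn_ord j))) _; exact: thr_homo.
rewrite max_r ?subr_le0// add0r mul0r mulr0.
have [zz1|] := leP (zz j.+1) (zz m); last by rewrite !mulr0.
suff -> : zz j.+1 - zz j = 0 by rewrite mul0r.
apply/eqP; rewrite eq_le !subr_le0 subr_ge0 (le_trans zz1) zz_homo//.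
  exact: ltnW.
Qed.

Lemma measurable_pot1 : measurable_fun setT (pot1 : measurableTypeR R ->
  measurableTypeR R).
Proof.
apply: measurable_funD; first by apply: measurable_funM.
apply: measurable_sum => j; apply: measurable_funM => //.
apply: measurable_maxr => //; exact: measurable_funB.
Qed.

Lemma measurable_pot2 : measurable_fun setT (pot2 : measurableTypeR R ->
  measurableTypeR R).
Proof.
apply: measurable_sum => j; apply: measurable_funM => //;
  apply: measurable_funM => //.
rewrite (_ : (fun z => _) = \1_(`[zz j.+1, +oo[%classic : set R)).
  exact: measurable_indic.
apply/funext => z; rewrite indicE (_ : (z \in _) = (zz j.+1 <= z))//.
by apply/idP/idP; rewrite inE/= in_itv/= andbT.
Qed.

Lemma pot_bounded a b : exists M, (forall w, w \in `[a, b] -> `|pot1 w| <= M) /\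
  (forall z, `|pot2 z| <= M).
Proof.
pose B := `|a| + `|b|.
pose M1 := `|zz 0| * B + \sum_(j < n) `|zz j.+1 - zz j| * (B + `|thr j.+1|).
pose M2 := \sum_(j < n) `|zz j.+1 - zz j| * `|thr j.+1|.
have M10 : 0 <= M1 by rewrite addr_ge0 ?mulr_ge0 ?addr_ge0// sumr_ge0// => j _;
  rewrite !mulr_ge0// !addr_ge0.
have M20 : 0 <= M2 by rewrite sumr_ge0// => j _; rewrite !mulr_ge0.
exists (M1 + M2); split=> [w wab|z].
  have wB : `|w| <= B.
    move: wab; rewrite in_itv/= => /andP[aw wb].
    rewrite ler_norml; have := ler_norm (- a); have := ler_norm b;
      rewrite normrN.
    have := normr_ge0 a; have := normr_ge0 b.
    by rewrite /B => ? ? ? ?; apply/andP; split; lra.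
  apply: (@le_trans _ _ M1); last by rewrite lerDl.
  apply: le_trans (ler_normD _ _) _; apply: lerD;
    first by rewrite normrM ler_wpM2l.
  apply: le_trans (ler_norm_sum _ _ _) _; apply: ler_sum => j _.
  rewrite normrM ler_wpM2l//.
  have : `|w - thr j.+1| <=
    B + `|thr j.+1| by rewrite (le_trans (ler_normB _ _))// lerD2r.
  by case: (leP (w - thr j.+1) 0) => // _ _; rewrite normr0 addr_ge0// addr_ge0.
apply: (@le_trans _ _ M2); last by rewrite lerDr.
apply: le_trans (ler_norm_sum _ _ _) _; apply: ler_sum => j _.
rewrite normrM ler_wpM2l// normrM.
by case: (zz j.+1 <= z); rewrite ?normr1 ?normr0 ?mulr1 ?mulr0.
Qed.

End Potentials.

(** * The randomized quantile transform *)

Lemma uniform_prob_le (R : realType) (s : R) :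
  uniform_prob (@ltr01 R) `]-oo, s]%classic = (Num.max 0 (Num.min s 1))%:E.
Proof.
rewrite /uniform_prob integral_uniform_pdf.
rewrite (eq_integral (cst 1%E)); last first.
  move=> x; rewrite inE/= => -[_]; rewrite in_itv/= /uniform_pdf => ->.
  by rewrite subr0 invr1.
have -> : `]-oo, s] `&` `[0%R, 1%R] = `[0, Num.min s 1]%classic :> set R.
  apply/seteqP; split=> x /=; rewrite !in_itv/= le_min.
    by move=> [-> /andP[-> ->]].
  by move=> /andP[-> /andP[-> ->]].
rewrite integral_cst//=.
rewrite mul1e lebesgue_measure_itv/= lte_fin.
by case: ltP => h //; rewrite EFinN sube0.
Qed.

Section RandomizedQuantile.
Context {R : realType} {d : measure_display} {X : measurableType d}.
Variables (Pr : probability X R) (n : nat) (w : 'I_n -> R).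
Variables (sigma : {perm 'I_n}) (J : X -> 'I_n) (V : X -> R).
Hypotheses (w0 : forall k, 0 <= w k) (w1 : \sum_k w k = 1).
Hypothesis mJ : forall B : set 'I_n, measurable (J @^-1` B).
Hypothesis PJ : forall k, Pr (J @^-1` [set k]) = (w k)%:E.
Hypothesis mV : measurable_fun setT V.
Hypothesis V01 : forall x, V x \in `[0, 1].
Hypothesis VJ : forall (A : set (measurableTypeR R)) (B : set 'I_n), measurable
  A ->
  Pr (V @^-1` A `&` J @^-1` B) = (Pr (V @^-1` A) * Pr (J @^-1` B))%E.
Hypothesis uV : forall A : set (measurableTypeR R), measurable A ->
  Pr (V @^-1` A) = uniform_prob (@ltr01 R) A.

Definition cumul (m : nat) : R := \sum_(j < n | (j < m)%N) w (sigma j).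

(** The level at which the quantile function is evaluated: a point of the
    interval of length [w (J x)] attached to the atom [J x]. *)
Definition spread (x : X) : R := V x * w (J x) + cumul (sigma^-1%g (J x)).

Lemma cumul0 : cumul 0 = 0.
Proof. by rewrite /cumul big_pred0. Qed.

Lemma cumulS (j : 'I_n) : cumul j.+1 = cumul j + w (sigma j).
Proof.
rewrite /cumul (bigD1 j)//= addrC; congr (_ + _); apply: eq_bigl => i.
by rewrite ltnS [RHS]ltn_neqAle andbC.
Qed.

Lemma cumul_full : cumul n = 1.
Proof.
rewrite -w1 [RHS](reindex_inj (@perm_inj _ sigma)).
by apply: eq_bigl => j; rewrite ltn_ord.
Qed.

Lemma cumul_homo m p : (m <= p)%N -> cumul m <= cumul p.
Proof.
move=> mp; rewrite /cumul [leRHS](bigID (fun j : 'I_n => (j < m)%N))/=.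
rewrite [X in _ <= X + _](eq_bigl (fun j : 'I_n => (j < m)%N)).
  by rewrite lerDl sumr_ge0.
by move=> j; apply/andb_idl => /leq_trans; apply.
Qed.

Lemma cumul_le1 m : cumul m <= 1.
Proof.
rewrite -w1 (reindex_inj (@perm_inj _ sigma))/= /cumul [leRHS](bigID (fun j :
  'I_n => (j < m)%N))/=.
by rewrite lerDl sumr_ge0.
Qed.

Lemma spread_itv x : cumul (sigma^-1%g (J x)) <= spread x <=
  cumul (sigma^-1%g (J x)).+1.
Proof.
rewrite cumulS permKV /spread; have := V01 x; rewrite in_itv/= => /andP[V0 V1].
by have wJ := w0 (J x); apply/andP; split; nra.
Qed.

Lemma spread_le1 x : spread x <= 1.
Proof. by have /andP[_ h] := spread_itv x; rewrite (le_trans h)// cumul_le1.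
  Qed.

Lemma measurable_spread : measurable_fun setT spread.
Proof.
apply: (@measurable_fun_index _ X n J mJ _ (measurableTypeR R)
  (fun k x => V x * w k + cumul (sigma^-1%g k))) => k.
by apply: measurable_funD => //; apply: measurable_funM.
Qed.

(** Conditionally on [J], the spread is uniform on an interval of length
    [w J], and these intervals tile [0, 1] in the order [sigma]; the sum over
    [J] telescopes. *)
Lemma spread_cdf c : 0 <= c <= 1 -> Pr [set x | spread x <= c] = c%:E.
Proof.
move=> /andP[c0 c1].
have mS : measurable [set x | spread x <= c].
  rewrite [X in measurable X](_ : _ = spread @^-1` `]-oo, c]%classic).
    by rewrite -[X in measurable X]setTI; apply: measurable_spread.
  by apply/seteqP; split=> x /=; rewrite in_itv.
pose D m := Num.min c (cumul m.+1) - Num.min c (cumul m).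
rewrite (measure_index mJ Pr mS) (eq_bigr (fun k => (D (sigma^-1%g k))%:E)) =>
  [|k _].
  rewrite sumEFin (reindex_inj (@perm_inj _ sigma))/=.
  under eq_bigr do rewrite permK.
  rewrite -(big_mkord xpredT D) (telescope_sumr (fun m =>
    Num.min c (cumul m)))//.
  by rewrite cumul_full cumul0 (min_l c1) (min_r c0) subr0.
set q := cumul (sigma^-1%g k).
have -> : [set x | spread x <= c] `&` J @^-1` [set k] =
    V @^-1` [set v | v * w k + q <= c] `&` J @^-1` [set k].
  by apply/seteqP; split=> x [/= h Jx]; split=> //; move: h; rewrite /spread Jx.
have mA : measurable ([set v | v * w k + q <= c] : set (measurableTypeR R)).
  rewrite [X in measurable X](_ : _ = (fun v =>
    v * w k + q) @^-1` `]-oo, c]%classic).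
    rewrite -[X in measurable X]setTI.
    have mg : measurable_fun setT (fun v : measurableTypeR R =>
      v * w k + q : measurableTypeR R).
      by apply: measurable_funD => //; apply: measurable_funM.
    exact: mg.
  by apply/seteqP; split=> v /=; rewrite in_itv.
rewrite VJ// PJ uV// /D cumulS permKV -/q.
have [wk0|wk0] := eqVneq (w k) 0; first by rewrite wk0 mule0 addr0 subrr.
have wk : 0 < w k by rewrite lt_neqAle eq_sym wk0 w0.
rewrite (_ : [set v | _] = `]-oo, (c - q) / w k]%classic); last first.
  by apply/seteqP; split=> v /=; rewrite in_itv/= ler_pdivlMr// lerBrDr.
rewrite uniform_prob_le -EFinM; congr EFin.
have : (c - q) / w k * w k = c - q by rewrite divfK.
move: (_ / _) => r rw.
case: (leP c q) => h1; case: (leP c (q + w k)) => h2;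
  case: (leP r 1) => h3; (case: (leP 0 _) => h4); nra.
Qed.

Context (a b : R) (mu : probability (measurableTypeR R) R).
Hypotheses (ab : a <= b) (mu1 : mu `[a, b]%classic = 1%E).

Let Y x := quantile a b mu (spread x).

Let mu_fin t : mu `[a, t]%classic \is a fin_num.
Proof.
by rewrite ge0_fin_numE// (le_lt_trans (probability_le1 _ _))// ltry.
Qed.

Lemma spread_quantile_itv x : Y x \in `[a, b].
Proof. by apply: quantile_itv => //; exact: spread_le1. Qed.

Lemma spread_quantile_le t :
  [set x | Y x <= t] =
  if t < a then set0 else
  if b <= t then setT else [set x | spread x <= fine (mu `[a, t]%classic)].
Proof.
case: ifPn => [ta|]; last rewrite -leNgt => at'.
  apply/seteqP; split=> x //= Yt.
  by have := spread_quantile_itv x; rewrite in_itv/= leNgt (le_lt_trans Yt).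
case: ifPn => [bt|]; last rewrite -ltNge => tb.
  apply/seteqP; split=> x //= _; apply: le_trans bt.
  by have := spread_quantile_itv x; rewrite in_itv/= => /andP[].
apply/seteqP; split=> x /=; rewrite /Y quantile_le// ?in_itv/= ?at' ?(ltW tb)//
  ?spread_le1// -(@fineK _ (mu _))//.
Qed.

Lemma measurable_spread_quantile : measurable_fun setT (Y : X ->
  measurableTypeR R).
Proof.
apply: (measurability _ (RGenOInfty.measurableE R)).
move=> _ [_ [t ->] <-]; rewrite setTI -setCitvl preimage_setC;
  apply: measurableC.
rewrite [X in measurable X](_ : _ = [set x | Y x <= t]); last first.
  by apply/seteqP; split=> x /=; rewrite in_itv.
rewrite spread_quantile_le; case: ifP => _ //; case: ifP => _ //.
rewrite [X in measurable X](_ : _ = spread @^-1` `]-oo, fine (mu `[a,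
  t]%classic)]%classic).
  by rewrite -[X in measurable X]setTI; apply: measurable_spread.
by apply/seteqP; split=> x /=; rewrite in_itv.
Qed.

(** Y <= t means spread <= F t, an event of probability [F t]. *)
Lemma spread_quantile_law (A : set (measurableTypeR R)) : measurable A ->
  Pr (Y @^-1` A) = mu A.
Proof.
pose Ym : {mfun X >-> measurableTypeR R} :=
  MeasurableFun.Pack (MeasurableFun.Class
    (isMeasurableFun.Build _ _ X (measurableTypeR R) Y
      measurable_spread_quantile)).
apply: (@probability_cdf_unique R (distribution Pr Ym) mu) => t.
transitivity (Pr [set x | Y x <= t]).
  by congr (Pr _); apply/seteqP; split=> x /=; rewrite in_itv.
rewrite spread_quantile_le [RHS](probability_setI_full _ _ mu1)//.
case: ifPn => [ta|]; last rewrite -leNgt => at'.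
    rewrite measure0 (_ : _ `&` _ = set0) ?measure0//.
  apply/seteqP; split=> x //= []; rewrite !in_itv/= => xt /andP[ax _].
  by move: ta; rewrite ltNge (le_trans ax xt).
case: ifPn => [bt|]; last rewrite -ltNge => tb.
  rewrite probability_setT (_ : _ `&` _ = `[a, b]%classic)//.
  apply/seteqP; split=> x /=; rewrite !in_itv/=; first by case.
  by move=> /andP[ax xb]; rewrite ax xb (le_trans xb bt).
rewrite spread_cdf ?fineK//.
  congr (mu _); apply/seteqP; split=> x /=; rewrite !in_itv/=.
    by move=> /andP[-> xt]; rewrite xt (le_trans xt (ltW tb)).
  by move=> [-> /andP[->]].
by rewrite fine_ge0//= -lee_fin fineK// probability_le1.
Qed.

Context (z : 'I_n -> R) (nu : probability (measurableTypeR R) R).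
Hypothesis z_homo : forall j k : 'I_n, (j <= k)%N -> z (sigma j) <= z (sigma k).
Hypothesis nuE : forall A : set (measurableTypeR R), measurable A ->
  Pr ((fun x => z (J x)) @^-1` A) = nu A.

(* The sorted positions of the atoms, extended by 0 beyond the last one. *)
Let zn (j : nat) : R := oapp (fun k => z (sigma k)) 0 (insub j).

Let thr (j : nat) : R := quantile a b mu (cumul j).

Let znE (k : 'I_n) : zn k = z (sigma k).
Proof. by rewrite /zn valK. Qed.

Let zn_homo i j : (i <= j)%N -> (j <= n.-1)%N -> zn i <= zn j.
Proof.
have [->|n0] := posnP n.
  by rewrite leqn0 => + /eqP j0; rewrite j0 leqn0 => /eqP ->.
move=> ij jn; have jn' : (j < n)%N by rewrite (leq_ltn_trans jn) ?ltn_predL.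
have := z_homo (j := Ordinal (leq_ltn_trans ij jn')) (k := Ordinal jn') ij.
by rewrite -!znE.
Qed.

Let thr_homo i j : (i <= j)%N -> thr i <= thr j.
Proof.
by move=> ij; apply: quantile_homo => //; [exact: cumul_homo|exact: cumul_le1].
Qed.

Let rank_le (k : 'I_n) : (k <= n.-1)%N.
Proof. by rewrite -ltnS (leq_trans (ltn_ord k))// leqSpred. Qed.

Let znJ k : zn (sigma^-1%g k) = z k.
Proof. by rewrite znE permKV. Qed.

Let spread_potential x : z (J x) * Y x =
  pot1 n.-1 zn thr (Y x) + pot2 n.-1 zn thr (z (J x)).
Proof.
have /andP[lo hi] := spread_itv x.
rewrite -znJ; apply: pot_eq => // [i j ij _|_|_]; first exact: thr_homo.
  by apply: quantile_homo => //; exact: spread_le1.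
by apply: quantile_homo => //; exact: cumul_le1.
Qed.

(** The pair (z J, Y) is comonotone, hence an optimal coupling: the potentials
    of the step coupling are tight along it. *)
Lemma OT_ge_spread :
  (- (\int[Pr]_x (z (J x) * Y x))%:E <= OT a b mu nu)%E.
Proof.
have mzJ : measurable_fun setT ((fun x => z (J x)) : X -> measurableTypeR R).
  by apply: (@measurable_fun_index _ X n J mJ _ (measurableTypeR R) (fun k _ =>
    z k)).
have mY := measurable_spread_quantile.
have mp1 := measurable_pot1 n.-1 zn thr.
have mp2 := measurable_pot2 n.-1 zn thr.
have [M [p1M p2M]] := pot_bounded n.-1 zn thr a b.
have mZ : measurable (range z : set (measurableTypeR R)).
  rewrite [X in measurable X](_ : _ = \bigcup_(k in [set: 'I_n]) [set z k]).
    exact: fin_bigcup_measurable.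
  by apply/seteqP; split=> [_ [k _ <-]|_ [k _ ->]]; exists k.
have nuZ : nu (range z) = 1%E.
  rewrite -nuE// -(probability_setT Pr); congr (Pr _).
  by apply/seteqP; split=> x //= _; exists (J x).
have i1 : Pr.-integrable setT (EFin \o (fun x => pot1 n.-1 zn thr (Y x))).
  apply: (@bounded_integrable _ _ _ Pr setT _ M) => //;
    first exact: measurableT_comp.
  by move=> x _; apply: p1M; exact: spread_quantile_itv.
have i2 : Pr.-integrable setT (EFin \o (fun x => pot2 n.-1 zn thr (z (J x)))).
  by apply: (@bounded_integrable _ _ _ Pr setT _ M) => //;
    exact: measurableT_comp.
have -> : \int[Pr]_x (z (J x) * Y x) =
    \int[mu]_(w in `[a, b]) pot1 n.-1 zn thr w + \int[nu]_(t in range z) pot2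
      n.-1 zn thr t.
  rewrite (eq_Rintegral _ (fun x _ => spread_potential x)) RintegralD//.
  congr (_ + _); congr fine.
    rewrite (@integral_law _ X R _ (measurableTypeR R) Y Pr mu `[a, b]%classic
      (fun w => (pot1 n.-1 zn thr w)%:E) mY spread_quantile_law)//;
        last exact/measurable_EFinP.
    congr (integral _ _ _); apply/seteqP; split=> x // _.
    exact: spread_quantile_itv.
  rewrite (@integral_law _ X R _ (measurableTypeR R) (fun x =>
    z (J x)) Pr nu (range z)
      (fun w => (pot2 n.-1 zn thr w)%:E) mzJ nuE)//;
        last exact/measurable_EFinP.
  by congr (integral _ _ _); apply/seteqP; split=> x // _; exists (J x).
apply: (OT_ge (M := M) mu1 mZ nuZ mp1 mp2) => //.
by move=> v _ _ [k _ <-]; rewrite -znJ; apply: pot_ge.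
Qed.

End RandomizedQuantile.

(** * The two-stage problem *)

(** The negative part is bounded, so a finite integral controls the positive
    part. *)
Lemma integrable_bounded_below d (T : measurableType d) (R : realType)
    (P : probability T R) (A : set T) (f : T -> \bar R) (c : R) :
  measurable A -> measurable_fun A f -> (forall x, A x -> (c%:E <= f x)%E) ->
  (\int[P]_(x in A) f x < +oo)%E -> P.-integrable A f.
Proof.
move=> mA mf fc fy; apply/integrableP; split=> //.
have neg_fin : (\int[P]_(x in A) f^\- x <= (`|c|)%:E)%E.
  apply: (@le_trans _ _ (\int[P]_(x in A) (cst (`|c|)%:E x))%E); last first.
    rewrite integral_cst//= -[leRHS]mule1 lee_wpmul2l ?lee_fin//.
    exact: probability_le1.
  apply: ge0_le_integral => //; first exact: measurable_funeneg.
  move=> x Ax; rewrite funenegE ge_max lee_fin normr_ge0 andbT leeNl.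
  by rewrite (le_trans _ (fc x Ax))// lee_fin lerNl -normrN ler_norm.
have neg_ge0 : (0 <= \int[P]_(x in A) f^\- x)%E by exact: integral_ge0.
have negy : (\int[P]_(x in A) f^\- x)%E \is a fin_num.
  by rewrite ge0_fin_numE// (le_lt_trans neg_fin)// ltry.
have posy : (\int[P]_(x in A) f^\+ x < +oo)%E.
  by move: fy; rewrite integralE lteBlDr// => /lt_le_trans; apply; rewrite leey.
rewrite (eq_integral (fun x => f^\+ x + f^\- x)%E) => [|x _]; last first.
  by rewrite -[LHS]/((abse \o f) x) fune_abse.
rewrite ge0_integralD//; [|exact: measurable_funepos|exact: measurable_funeneg].
by rewrite lte_add_pinfty// ltey_eq negy.
Qed.

Section Dotv.
Context {R : realType} {n : nat}.
Implicit Types u v w : 'cV[R]_n.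

Lemma dotvDl u v w : dotv (u + v) w = dotv u w + dotv v w.
Proof. by rewrite /dotv -big_split; apply: eq_bigr => j _; rewrite mxE mulrDl.
  Qed.

Lemma dotvNl u w : dotv (- u) w = - dotv u w.
Proof. by rewrite /dotv -sumrN; apply: eq_bigr => j _; rewrite mxE mulNr. Qed.

Lemma dotv_sumr I (s : seq I) (c : I -> R) (v : I -> 'cV[R]_n) u :
  dotv u (\sum_(k <- s) c k *: v k) = \sum_(k <- s) dotv u (v k) * c k.
Proof.
rewrite /dotv; under [RHS]eq_bigr do rewrite mulr_suml.
rewrite exchange_big/=; apply: eq_bigr => j _.
rewrite summxE mulr_sumr; apply: eq_bigr => k _.
by rewrite mxE; ring.
Qed.

Lemma ler_dotvl u v w : lev 0 w -> lev u v -> dotv u w <= dotv v w.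
Proof.
move=> w0 uv; apply: ler_sum => j _; apply: ler_wpM2r => //.
by have := w0 j; rewrite mxE.
Qed.

Lemma ler_dotv_neg u v w : lev w 0 -> lev u v -> dotv v w <= dotv u w.
Proof.
move=> w0 uv; apply: ler_sum => j _; rewrite ler_wnM2r//.
by have := w0 j; rewrite mxE.
Qed.

End Dotv.

Lemma dotv_mulmx (R : realType) m n (A : 'M[R]_(m, n)) x l :
  dotv (A *m x) l = dotv (A^T *m l) x.
Proof.
rewrite /dotv; under eq_bigr do rewrite mxE mulr_suml.
under [RHS]eq_bigr do rewrite mxE mulr_suml.
rewrite exchange_big/=; apply: eq_bigr => j _; apply: eq_bigr => i _.
by rewrite mxE; ring.
Qed.

Section Problem.
Context {R : realType} {d k1 n_in n_eq m_in m_eq k2 : nat}.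
Variable D : dro_data R d k1 n_in n_eq m_in m_eq k2.
Hypothesis hD : dro_setting D.

Lemma second_stageE x (w : 'cV[R]_d) l :
  dotv (Q D *m x + P D *m w + b D) l =
  dotv (Q D *m x + b D) l + \sum_i dotv (p_ D i) l * w i 0.
Proof.
rewrite -addrA [P D *m w + _]addrC addrA dotvDl; congr (_ + _).
rewrite dotv_mulmx; apply: eq_bigr => i _; congr (_ * _).
by rewrite mxE; apply: eq_bigr => j _; rewrite !mxE.
Qed.

Lemma measurable_halfspace n (u : 'cV[R]_n) (c : R) :
  measurable ([set l | dotv u l <= c] : set (vborel R n)).
Proof.
rewrite [X in measurable X](_ : _ = bdotv u @^-1` `]-oo, c]%classic).
  by rewrite -[X in measurable X]setTI; exact: measurable_dotv.
by apply/seteqP; split=> v /=; rewrite in_itv.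
Qed.

Lemma measurable_Omega : measurable (Omega D : set (vborel R d)).
Proof.
apply: forall_fin_measurable => i.
have := @measurable_coord R d i measurableT (Omega_ D i) (measurable_itv _).
by rewrite setTI.
Qed.

Lemma measurable_S2star : measurable (S2star D : set (vborel R (m_in + m_eq))).
Proof.
apply: measurableI.
  apply: forall_fin_measurable => j.
  (* a sign constraint is the half-space cut by a basis vector *)
  rewrite [X in measurable X](_ : _ =
      [set l : 'cV[R]_(m_in + m_eq) | dotv (delta_mx (lshift m_eq j) 0) l <=
        0]).
    exact: measurable_halfspace.
  apply/seteqP; split=> l /=;
    rewrite !mxE /dotv (bigD1 (lshift m_eq j))//= big1 ?addr0;
    try (by move=> i ij; rewrite mxE (negbTE ij) mul0r).
  by rewrite mxE !eqxx mul1r.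
  by rewrite mxE !eqxx mul1r.
pose M := row_mx (A_in D)^T (A_eq D)^T.
rewrite [X in measurable X](_ : _ = [set l : vborel R (m_in + m_eq) |
    forall j, dotv ((row j M)^T) l <= c2 D j 0]).
  by apply: forall_fin_measurable => j; exact: measurable_halfspace.
have ME (l : 'cV[R]_(m_in + m_eq)) j :
    ((A_in D)^T *m usubmx l + (A_eq D)^T *m dsubmx l) j 0 = dotv ((row j M)^T)
      l.
  rewrite -mul_row_col vsubmxK /M !mxE; apply: eq_bigr => i _.
  by rewrite !mxE.
by apply/seteqP; split=> l /= h j; have := h j; rewrite ME.
Qed.

Lemma C2_ge x (w : 'cV[R]_d) l : S2star D l ->
  ((dotv (Q D *m x + b D) l + \sum_i dotv (p_ D i) l * w i 0)%:E <= C2 D x w)%E.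
Proof.
by move=> Sl; apply: ereal_sup_ubound; exists l => //; rewrite second_stageE.
Qed.

(** A supremum of functions affine in the second argument. *)
Lemma measurable_C2 x : measurable_fun setT (C2 D x : vborel R d -> \bar R).
Proof.
apply: (measurability _ (ErealGenOInfty.measurableE R)).
move=> _ [_ [a ->] <-]; rewrite setTI preimage_itvoy.
apply: sub_sigma_algebra.
apply: (@open_gt_sup_continuous R 'cV[R]_d _ (S2star D)
  (fun l w => dotv (Q D *m x + P D *m w + b D) l)) => l.
have -> : (fun w => dotv (Q D *m x + P D *m w + b D) l) =
    (fun w => dotv (Q D *m x + b D) l + dotv ((P D)^T *m l) w).
  apply/funext => w; rewrite second_stageE; congr (_ + _); apply: eq_bigr =>
    i _; congr (_ * _).
  by rewrite mxE; apply: eq_bigr => j _; rewrite !mxE.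
move=> w; apply: (@continuousD _ R _ (cst (dotv (Q D *m x + b D) l))).
  exact: cst_continuous.
exact: continuous_dotv.
Qed.

Lemma conjugate_integral_gtNy (f : R -> R) i :
  (-oo < \int[marg D i]_(w in Omega_ D i) conjugate f w)%E.
Proof.
apply: (@lt_le_trans _ _ (- f 0)%:E); first exact: ltNyr.
have mO : measurable (Omega_ D i : set (measurableTypeR R)) by exact:
  measurable_itv.
have -> : (- f 0)%:E = (\int[marg D i]_(w in Omega_ D i) (cst (- f 0)%:E w))%E.
  rewrite integral_cst// [X in (_ * X)%E](_ : _ = 1%E) ?mule1//.
  exact (marg_Omega hD i).
apply: le_integral_measurable => //.
  apply: (@measurable_funTS _ _ (measurableTypeR R));
    exact: measurable_conjugate.
by move=> w _ /=; rewrite (le_trans _ (conjugate_ge f 0 w))// mul0r sub0r.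
Qed.

Lemma Gamma_integral mu i (h : measurableTypeR R -> \bar R) : Gamma D mu ->
  measurable_fun setT h ->
  (\int[marg D i]_(w in Omega_ D i) h w = \int[mu]_(w in Omega D) h ((w :
    'cV[R]_d) i 0%R))%E.
Proof.
move=> [muO mui] mh.
have mO : measurable (Omega_ D i : set (measurableTypeR R)) by exact:
  measurable_itv.
have mc := @measurable_coord R d i.
rewrite (@integral_law _ (vborel R d) R _ (measurableTypeR R) _ mu (marg D i)
  (Omega_ D i) h mc (mui i))//.
apply: integral_full => //.
- exact: measurable_Omega.
- by rewrite -[X in measurable X]setTI; exact: mc.
- by move=> w; exact.
- exact/measurable_funTS/measurableT_comp.
Qed.

(** Young's inequality z w <= f z + f^* w at z = <p_i, l> bounds every second-stage
    value by the slack plus the conjugates; integrating against [mu] only sees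
    its marginals. *)
Lemma inner_obj_le x (f : 'I_d -> R -> R) e mu : Gamma D mu ->
  (forall l, S2star D l -> slack D x f l <= e) ->
  (inner_obj D x mu <=
   e%:E + \sum_i \int[marg D i]_(w in Omega_ D i) conjugate (f i) w)%E.
Proof.
move=> Gmu hs; pose I i :=
  (\int[marg D i]_(w in Omega_ D i) conjugate (f i) w)%E.
have INy i : (-oo < I i)%E by exact: conjugate_integral_gtNy.
have mO := measurable_Omega.
have mconj i : measurable_fun (Omega D : set (vborel R d))
    (fun w : vborel R d => conjugate (f i) ((w : 'cV[R]_d) i 0%R)).
  apply: measurable_funTS.
  by apply: measurableT_comp;
    [exact: measurable_conjugate|exact: measurable_coord].
(* an infinite conjugate integral makes the right-hand side infinite *)
have [Iy|/existsNP[i /negP]] := pselect (forall i, I i < +oo)%E; last first.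
  rewrite -leNgt leye_eq => /eqP Iy.
  rewrite (_ : (\sum_i _)%E = +oo%E) ?addey ?leey//.
  apply/eqP; rewrite esum_eqy; last by move=> j _; rewrite -ltNye; exact: INy.
  by apply/existsP; exists i; apply/eqP; exact: Iy.
have iconj i : mu.-integrable (Omega D)
    (fun w : vborel R d => conjugate (f i) ((w : 'cV[R]_d) i 0%R)).
  apply: (@integrable_bounded_below _ _ _ _ _ _ (- f i 0)) => //.
    move=> w _; rewrite (le_trans _ (conjugate_ge (f i) 0 _))// mul0r sub0r//.
  rewrite -(Gamma_integral i Gmu) ?Iy//; exact: measurable_conjugate.
have -> : (e%:E + \sum_i I i =
    \int[mu]_(w in Omega D) (e%:E + \sum_i conjugate (f i) ((w : 'cV[R]_d) i
      0%R)))%E.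
  rewrite integralD//; last 2 first.
  - exact: finite_measure_integrable_cst.
  - exact: integrable_sum.
  rewrite integral_cst// [X in (_ * X)%E](_ : _ = 1%E) ?mule1;
    last exact: Gmu.1.
  rewrite integral_sum//; congr (_ + _)%E.
  by apply: eq_bigr => i _; apply: (Gamma_integral i Gmu);
    exact: measurable_conjugate.
apply: le_integral_measurable => //.
- by apply: (@measurable_funTS _ _ (vborel R d)); exact: measurable_C2.
- apply: emeasurable_funD => //.
  by apply: emeasurable_sum => i; exact: mconj.
move=> w _; apply: ge_ereal_sup => _ [l Sl <-]; rewrite second_stageE.
apply: (@le_trans _ _ (e%:E + \sum_i (dotv (p_ D i) l * w i 0 - f i (dotv (p_ D
  i) l))%:E)%E).
  rewrite sumEFin -EFinD lee_fin sumrB.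
  by have := hs _ Sl; rewrite /slack => h; lra.
by rewrite leeD2l//; apply: lee_sum => i _; exact: conjugate_ge.
Qed.

End Problem.

Section Bounds.
Context {R : realType} {d k1 n_in n_eq m_in m_eq k2 : nat}.
Variable D : dro_data R d k1 n_in n_eq m_in m_eq k2.
Hypothesis hD : dro_setting D.

Lemma C2_ubound : exists M : R, forall x w, S1 D x -> Omega D w ->
  (C2 D x w <= M%:E)%E.
Proof.
have := C2_bounded hD; set s := ereal_sup _ => sy.
have sP x w : S1 D x -> Omega D w -> (C2 D x w <= s)%E.
  by move=> Sx Ow; apply: ereal_sup_ubound; exists x => //; exists w.
move: sy sP; case: s => [r|//|] _ sP; first by exists r.
by exists 0 => x w Sx Ow; rewrite (le_trans (sP _ _ Sx Ow))// leNye.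
Qed.

(** The supremum defining [eps_vio] is finite: a subgradient of each [f i] at
    <p_i, l> lies in [Omega_ i], and linearizing [f i] there bounds the slack by a
    constant plus a second-stage cost. *)
Lemma slack_le_eps_vio x (f : 'I_d -> R -> R) : S1 D x ->
  (forall i, C_cvx (f i)) -> (forall i z, subdiff (f i) z `<=` Omega_ D i) ->
  forall l, S2star D l -> slack D x f l <= eps_vio D x f.
Proof.
move=> Sx hf f6 l Sl; apply: ub_le_sup; last by exists l.
have [M hM] := C2_ubound.
exists (\sum_i f i 0 + M) => _ [t St <-].
have [s hs] := choice (fun i => subdiff_nonempty (dotv (p_ D i) t) (hf i)).
have Os : Omega D (\col_i s i) by move=> i /=; rewrite mxE; exact: f6 (hs i).
have := le_trans (C2_ge x (\col_i s i) St) (hM _ _ Sx Os); rewrite lee_fin => h.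
have : \sum_i f i (dotv (p_ D i) t) <=
    \sum_i f i 0 + \sum_i dotv (p_ D i) t * (\col_i s i) i 0.
  rewrite -big_split/=; apply: ler_sum => i _; rewrite mxE.
  by have := hs i 0; rewrite sub0r mulrN; lra.
by rewrite /slack; lra.
Qed.

(** Weak duality for the linear program of the first stage. *)
Lemma first_stage_ge x xi_in xi_eq m : S1 D x -> lev xi_in 0 ->
  lev ((L_in D)^T *m xi_in + (L_eq D)^T *m xi_eq) (c1 D + (Q D)^T *m m) ->
  dotv (q_in D) xi_in + dotv (q_eq D) xi_eq <=
    dotv (c1 D) x + dotv (Q D *m x) m.
Proof.
move=> [x0 Lx Lq] xi0 hxi.
have := ler_dotvl x0 hxi; rewrite !dotvDl -!dotv_mulmx Lq.
by have := ler_dotv_neg xi0 Lx; lra.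
Qed.

(** Complementary slackness closes the gap of the preceding inequality. *)
Lemma first_stage_eq x xi_in xi_eq m : S1 D x ->
  dotv (L_in D *m x - q_in D) xi_in = 0 ->
  dotv (c1 D + (Q D)^T *m m - (L_in D)^T *m xi_in - (L_eq D)^T *m xi_eq) x = 0
    ->
  dotv (c1 D) x + dotv (Q D *m x) m = dotv (q_in D) xi_in + dotv (q_eq D) xi_eq.
Proof.
move=> [_ _ Lq]; rewrite !dotvDl !dotvNl -!dotv_mulmx Lq.
by lra.
Qed.

End Bounds.

(** * The comonotone coupling of the marginals with tau *)

Section Coupling.
Context {R : realType} {d k1 n_in n_eq m_in m_eq k2 : nat}.
Variable D : dro_data R d k1 n_in n_eq m_in m_eq k2.
Hypothesis hD : dro_setting D.
Variables (tau : probability (vborel R (m_in + m_eq)) R) (K : nat).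
Variable lam : 'I_K -> 'cV[R]_(m_in + m_eq).
Hypotheses (lamI : injective lam) (tau_lam : tau (range lam) = 1%E).

Definition weight (k : 'I_K) : R := fine (tau [set lam k]).

Definition mean_atoms : 'cV[R]_(m_in + m_eq) := \sum_k weight k *: lam k.

Lemma weightE k : tau [set lam k] = (weight k)%:E.
Proof.
rewrite /weight fineK// ge0_fin_numE//
  (le_lt_trans (probability_le1 _ _)) ?ltry//.
exact: measurable_vborel_set1.
Qed.

Lemma weight_ge0 k : 0 <= weight k.
Proof. by rewrite /weight fine_ge0. Qed.

Lemma sum_weight : \sum_k weight k = 1.
Proof.
exact: (@sum_atoms _ (vborel R (m_in + m_eq)) R tau K lam lamI
  (fun k => measurable_vborel_set1 (lam k)) tau_lam).
Qed.

Lemma integral_tau (A : set (vborel R (m_in + m_eq)))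
    (g : vborel R (m_in + m_eq) -> R) :
  measurable A -> range lam `<=` A -> measurable_fun A g ->
  (\int[tau]_(l in A) (g l)%:E = (\sum_k g (lam k) * weight k)%:E)%E.
Proof.
exact: (@integral_atoms _ (vborel R (m_in + m_eq)) R tau K lam lamI
  (fun k => measurable_vborel_set1 (lam k)) tau_lam).
Qed.

Lemma QTmeanE : range lam `<=` S2star D -> QTmean D tau = (Q D)^T *m mean_atoms.
Proof.
move=> lamS; apply/matrixP => j o; rewrite (ord1 o) mxE /Rintegral.
have E (l : 'cV[R]_(m_in + m_eq)) : ((Q D)^T *m l) j 0 = dotv (col j (Q D)) l.
  by rewrite mxE; apply: eq_bigr => i _; rewrite !mxE.
rewrite integral_tau//; last 2 first.
- exact: measurable_S2star.
- under eq_fun do rewrite E.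
  by apply: (@measurable_funTS _ _ (vborel R (m_in + m_eq)));
    exact: measurable_dotv.
rewrite /= E dotv_sumr.
by apply: eq_bigr => k _; rewrite E.
Qed.

Variables (sigma : 'I_d -> {perm 'I_K}) (dX : measure_display).
Variables (X : measurableType dX) (Pr : probability X R).
Variables (J : X -> 'I_K) (U : {RV Pr >-> vborel R d}).
Hypothesis sigma_sorted : forall i (j k : 'I_K), (j <= k)%N ->
  dotv (p_ D i) (lam (sigma i j)) <= dotv (p_ D i) (lam (sigma i k)).
Hypothesis mJ : forall B : set 'I_K, measurable (J @^-1` B).
Hypothesis PJ : forall j, Pr (J @^-1` [set j]) = tau [set lam j].
Hypothesis U01 : forall w i, (U w : 'cV[R]_d) i 0 \in `[0, 1].
Hypothesis UJ : forall (A : set (vborel R d)) (B : set 'I_K), measurable A ->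
  Pr (U @^-1` A `&` J @^-1` B) = (Pr (U @^-1` A) * Pr (J @^-1` B))%E.
Hypothesis uU : forall i (A : set (measurableTypeR R)), measurable A ->
  Pr [set w | A ((U w : 'cV[R]_d) i 0)] = uniform_prob (@ltr01 R) A.

Let Y := Yvec D tau lam sigma J U.

(** The opposite of the transport cost of the coupling of [marg D i] with the law
    of <p_i, lam J>. *)
Definition reward i : R := \int[Pr]_x (dotv (p_ D i) (lam (J x)) * Y x i 0).

Let V i (x : X) : R := (U x : 'cV[R]_d) i 0.

Let PJ' k : Pr (J @^-1` [set k]) = (weight k)%:E.
Proof. by rewrite PJ weightE. Qed.

Let mV i : measurable_fun setT (V i : X -> measurableTypeR R).
Proof. by apply: (measurableT_comp (measurable_coord i)). Qed.

Let VJ i (A : set (measurableTypeR R)) (B : set 'I_K) : measurable A ->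
  Pr (V i @^-1` A `&` J @^-1` B) = (Pr (V i @^-1` A) * Pr (J @^-1` B))%E.
Proof.
move=> mA; apply: (UJ (A := [set v : 'cV[R]_d | A (v i 0)])).
by have := measurable_coord i measurableT mA; rewrite setTI.
Qed.

Let muO i : marg D i `[omega_lo D i, omega_hi D i]%classic = 1%E.
Proof. exact (marg_Omega hD i). Qed.

Let YE i x : Y x i 0 = quantile (omega_lo D i) (omega_hi D i) (marg D i)
  (spread weight (sigma i) J (V i) x).
Proof. by rewrite /Y /Yvec mxE. Qed.

Let Yi_fun i : (fun x => Y x i 0) = (fun x =>
  quantile (omega_lo D i) (omega_hi D i)
  (marg D i) (spread weight (sigma i) J (V i) x)).
Proof. by apply/funext => x; rewrite YE. Qed.

Let mYi i : measurable_fun setT ((fun x => Y x i 0) : X -> measurableTypeR R).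
Proof.
rewrite Yi_fun; apply: measurable_spread_quantile => //.
- exact: weight_ge0.
- exact: sum_weight.
- exact: mV.
- by move=> x; exact: U01.
- exact: omega_le.
Qed.

Let mY : measurable_fun setT (Y : X -> vborel R d).
Proof. by apply: measurable_fun_vborel => i; exact: mYi. Qed.

Let Y_Omega x : Omega D (Y x).
Proof.
move=> i; rewrite /Omega_/= YE; apply: spread_quantile_itv => //.
- exact: weight_ge0.
- exact: sum_weight.
- by move=> y; exact: U01.
- exact: omega_le.
Qed.

Let law_lam (B : set (vborel R (m_in + m_eq))) : measurable B ->
  Pr ((fun x => lam (J x)) @^-1` B) = tau B.
Proof.
move=> mB.
have mA : measurable ((fun x => lam (J x)) @^-1` B).
  exact: (mJ (lam @^-1` B)).
transitivity (\sum_k \1_B (lam k) * weight k)%:E.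
  rewrite -[X in Pr X]setIT -integral_indic//.
  rewrite (@integral_index _ X R K J mJ Pr (fun k => \1_B (lam k))).
  by congr EFin; apply: eq_bigr => k _; rewrite PJ.
rewrite -[X in tau X]setIT -integral_indic//.
apply/esym; apply: (@integral_tau setT (\1_B : vborel R (m_in + m_eq) -> R)) =>
  //.
Qed.

Let Ym : {RV Pr >-> vborel R d} := MeasurableFun.Pack (MeasurableFun.Class
    (isMeasurableFun.Build _ _ X (vborel R d) Y mY)).

Lemma coupling_RV : {Ym : {RV Pr >-> vborel R d} | forall x, Ym x = Y x}.
Proof. by exists Ym. Qed.

Variable Y' : {RV Pr >-> vborel R d}.
Hypothesis Y'E : forall x, Y' x = Y x.

(** Each coordinate of Y is a randomized quantile transform of its marginal. *)
Lemma coupling_Gamma : Gamma D (distribution Pr Y').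
Proof.
split.
  rewrite -[RHS](probability_setT Pr); congr (Pr _).
  by apply/seteqP; split=> x //= _; rewrite Y'E; exact: Y_Omega.
move=> i A mA; rewrite -(@spread_quantile_law R dX X Pr K weight (sigma i) J (V
  i) weight_ge0 sum_weight mJ PJ' (mV i) _ (VJ i) (uU i) _ _ (marg D i)
    (omega_le hD i) (muO i) A mA).
  congr (Pr _); apply/seteqP; split=> x /=; rewrite Y'E YE //.
by move=> x; exact: U01.
Qed.

Lemma coupling_OT i :
  (- (reward i)%:E <= OT (omega_lo D i) (omega_hi D i) (marg D i) (law_dotv (p_
    D i) tau))%E.
Proof.
rewrite /reward (eq_Rintegral _ (fun x _ => congr1 _ (YE i x))).
apply: (@OT_ge_spread R dX X Pr K weight (sigma i) J (V i) weight_ge0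
  sum_weight mJ PJ' (mV i) _ (VJ i) (uU i) _ _ (marg D i) (omega_le hD i) (muO
    i) (fun k => dotv (p_ D i) (lam k))).
- by move=> x; exact: U01.
- exact: sigma_sorted.
- move=> A mA.
  have mB : measurable (bdotv (p_ D i) @^-1` A : set (vborel R (m_in + m_eq))).
    by rewrite -[X in measurable X]setTI; exact: measurable_dotv.
  exact: (law_lam mB).
Qed.

(** The second-stage maximum at Y is at least the value at the feasible point
    [lam J], whose expectation separates into a first-stage part and the rewards. *)
Lemma coupling_inner_obj x : range lam `<=` S2star D ->
  ((dotv (Q D *m x + b D) mean_atoms + \sum_i reward i)%:E
     <= inner_obj D x (distribution Pr Y'))%E.
Proof.
move=> lamS; rewrite /inner_obj.
have mO := @measurable_Omega R d k1 n_in n_eq m_in m_eq k2 D.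
have mC := @measurable_C2 R d k1 n_in n_eq m_in m_eq k2 D x.
rewrite (@integral_law _ X R _ (vborel R d) Y Pr (distribution Pr Y') (Omega D)
  (C2 D x) mY _ mO mC); last first.
  move=> A mA; rewrite /distribution /pushforward/=; congr (Pr _).
  by apply/seteqP; split=> y /=; rewrite Y'E.
rewrite (_ : Y @^-1` Omega D = setT); last first.
  by apply/seteqP; split=> y // _; exact: Y_Omega.
pose g i y := dotv (p_ D i) (lam (J y)) * Y y i 0.
pose h y := dotv (Q D *m x + b D) (lam (J y)).
have mh : measurable_fun setT (h : X -> measurableTypeR R).
  by apply: (@measurable_fun_index _ X K J mJ _ (measurableTypeR R)
    (fun k _ => dotv (Q D *m x + b D) (lam k))).
have mz i : measurable_fun setT ((fun y => dotv (p_ D i) (lam (J y))) : X ->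
  measurableTypeR R).
  by apply: (@measurable_fun_index _ X K J mJ _ (measurableTypeR R)
    (fun k _ => dotv (p_ D i) (lam k))).
have mg i : measurable_fun setT (g i : X -> measurableTypeR R).
  by apply: measurable_funM; [exact: mz|exact: mYi].
have sum_ge (c : 'I_K -> R) k : `|c k| <= \sum_j `|c j|.
  by rewrite (bigD1 k)//= lerDl sumr_ge0.
have ih : Pr.-integrable setT (EFin \o h).
  apply: (@bounded_integrable _ _ _ Pr setT _ (\sum_k `|dotv (Q D *m x + b D)
    (lam k)|)) => //.
  by move=> y _; exact: (sum_ge (fun k => dotv (Q D *m x + b D) (lam k))).
have ig i : Pr.-integrable setT (EFin \o g i).
  apply: (@bounded_integrable _ _ _ Pr setT _
    ((\sum_k `|dotv (p_ D i) (lam k)|) * (`|omega_lo D i| + `|omega_hi D i|)))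
      => //; first exact: mg.
  move=> y _; rewrite normrM ler_pM//; first exact: (sum_ge (fun k =>
    dotv (p_ D i) (lam k))).
  have := Y_Omega y i; rewrite /Omega_/= in_itv/= => /andP[lo hi].
  rewrite ler_norml; have := ler_norm (- omega_lo D i); have :=
    ler_norm (omega_hi D i).
  have := normr_ge0 (omega_lo D i); have := normr_ge0 (omega_hi D i).
  by rewrite normrN => ? ? ? ?; apply/andP; split; lra.
have -> : (dotv (Q D *m x + b D) mean_atoms + \sum_i reward i)%:E =
    (\int[Pr]_y ((h y)%:E + \sum_i (g i y)%:E))%E.
  have isum : Pr.-integrable setT (fun y => \sum_i (g i y)%:E)%E.
    by apply: integrable_sum => // i _; exact: ig.
  rewrite integralD//.
  rewrite integral_sum//= (@integral_index _ X R K J mJ Pr (fun k =>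
    dotv (Q D *m x + b D) (lam k))).
  rewrite EFinD; congr (_ + _)%E.
    by congr EFin; rewrite dotv_sumr; apply: eq_bigr => k _; rewrite PJ.
  rewrite -sumEFin; apply: eq_bigr => i _.
  by rewrite /reward /Rintegral fineK//;
    exact: (integrable_fin_num measurableT (ig i)).
apply: le_integral_measurable => //.
- apply: emeasurable_funD; first exact/measurable_EFinP.
  by apply: emeasurable_sum => i; apply/measurable_EFinP; exact: mg.
- by apply: (measurableT_comp mC).
- by move=> y _; rewrite sumEFin -EFinD; apply: C2_ge; apply: lamS;
  exists (J y).
Qed.

End Coupling.

(** * A probability space carrying the coupling *)

Lemma finite_set_enum (T : choiceType) (V : set T) (v0 : T) : finite_set V ->
  exists K (lam : 'I_K -> T), injective lam /\ range lam = V.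
Proof.
move=> /finite_seqP[s Vs].
exists (size (undup s)), (fun k => nth v0 (undup s) k); split.
  by move=> j k /eqP; rewrite nth_uniq ?undup_uniq// => /eqP /val_inj.
rewrite Vs; apply/seteqP; split=> [_ [k _ <-]|t /= ts].
  by rewrite /= -mem_undup mem_nth.
have ti : (index t (undup s) < size (undup s))%N by rewrite index_mem mem_undup.
by exists (Ordinal ti) => //=; rewrite nth_index// mem_undup.
Qed.

Lemma sorting_perm (R : realType) K (h : 'I_K -> R) :
  exists s : {perm 'I_K}, forall j k : 'I_K, (j <= k)%N -> h (s j) <= h (s k).
Proof.
pose r := [rel j k | h j <= h k]; pose t := sort r (enum 'I_K).
have st : size t = K by rewrite size_sort size_enum_ord.
have ut : uniq t by rewrite sort_uniq enum_uniq.
have inj : injective (fun j : 'I_K => nth j t j).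
  move=> j k; rewrite (set_nth_default j k) ?st// => /eqP.
  by rewrite nth_uniq ?st// => /eqP /val_inj.
exists (perm inj) => j k jk; rewrite !permE (set_nth_default j k) ?st//.
have tr : sorted r t by apply: sort_sorted => y z; exact: le_total.
have rtr : transitive r by move=> y x z; exact: le_trans.
have rre : reflexive r by move=> y /=.
have := @sorted_leq_nth _ r rtr rre j t tr j k; rewrite !inE st !ltn_ord.
by apply.
Qed.

Section CouplingSpace.
Context {R : realType} {n d K : nat}.
Variables (tau : probability (vborel R n) R) (lam : 'I_K ->
  'cV[R]_n) (k0 : 'I_K).
Hypotheses (lamI : injective lam) (tau_lam : tau (range lam) = 1%E).

(** Off the atoms, a null set, the index takes an arbitrary value. *)
Definition atom_index (l : vborel R n) : 'I_K :=
  odflt k0 [pick k | lam k == l].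

Lemma atom_indexK k : atom_index (lam k) = k.
Proof.
rewrite /atom_index; case: pickP => [j /eqP/lamI//|/(_ k)].
by rewrite eqxx.
Qed.

Lemma atom_index_out l : ~ range lam l -> atom_index l = k0.
Proof.
rewrite /atom_index; case: pickP => // k /eqP <- h; case: h; by exists k.
Qed.

Lemma measurable_sub_range (B : set 'I_K) :
  measurable ((lam @` B) : set (vborel R n)).
Proof.
rewrite [X in measurable X](_ : _ = \bigcup_(k in B) [set lam k]).
  apply: fin_bigcup_measurable => [|k _]; first exact: finite_finset.
  exact: measurable_vborel_set1.
by apply/seteqP; split=> [_ [k Bk <-]|_ [k Bk ->]]; exists k.
Qed.

Lemma measurable_atom_index (B : set 'I_K) : measurable (atom_index @^-1` B).
Proof.
have mC : measurable (~` range lam : set (vborel R n)).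
  by apply: measurableC; exact: measurable_sub_range.
have [Bk0|Bk0] := pselect (B k0).
  rewrite (_ : _ @^-1` B = (lam @` B) `|` ~` range lam).
    by apply: measurableU => //; exact: measurable_sub_range.
  apply/seteqP; split=> [l /= Bl|l [[k Bk <-]|lV]] /=.
  - have [[k _ kl]|] := pselect (range lam l); last by right.
    by left; exists k => //; move: Bl; rewrite -kl atom_indexK.
  - by rewrite atom_indexK.
  - by rewrite atom_index_out.
rewrite (_ : _ @^-1` B = (lam @` B)); first exact: measurable_sub_range.
apply/seteqP; split=> [l /= Bl|l [k Bk <-]] /=; last by rewrite atom_indexK.
have [[k _ kl]|lV] := pselect (range lam l).
  by exists k => //; move: Bl; rewrite -kl atom_indexK.
by move: Bl; rewrite atom_index_out.
Qed.

Lemma tau_atom_index k : tau (atom_index @^-1` [set k]) = tau [set lam k].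
Proof.
rewrite (probability_setI_full (measurable_atom_index [set k])
  (measurable_sub_range setT) tau_lam).
congr (tau _); apply/seteqP; split=> [l [/= h [j _ jl]]|_ ->].
  by move: h; rewrite -jl atom_indexK => ->.
by split; [exact: atom_indexK|exists k].
Qed.

Let unif : probability (measurableTypeR R) R := uniform_prob (@ltr01 R).

(** The uniform law charges [0, 1] only almost surely, while the uniform variables
    of the coupling take all their values there. *)
Definition clamp01 (u : R) : R := Num.max 0 (Num.min u 1).

Lemma clamp01_itv u : clamp01 u \in `[0, 1].
Proof. by rewrite in_itv/= le_max lexx/= ge_max ler01 ge_min lexx orbT. Qed.

Lemma measurable_clamp01 : measurable_fun setT (clamp01 : measurableTypeR R ->
  measurableTypeR R).
Proof. by apply: measurable_maxr => //; exact: measurable_minr. Qed.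

Lemma uniform_clamp01 (A : set (measurableTypeR R)) : measurable A ->
  unif (clamp01 @^-1` A) = unif A.
Proof.
move=> mA.
have mI : measurable (`[0, 1]%classic : set (measurableTypeR R)) by exact:
  measurable_itv.
have u1 : unif `[0, 1]%classic = 1%E by exact: integral_uniform_pdf1.
have mcA : measurable (clamp01 @^-1` A : set (measurableTypeR R)).
  by rewrite -[X in measurable X]setTI; exact: measurable_clamp01.
rewrite (probability_setI_full mcA mI u1) (probability_setI_full mA mI u1).
congr (unif _); apply/seteqP; split=> u [/= Au]; rewrite in_itv/= =>
  /andP[u0 u1'];
  by split; rewrite /= ?in_itv/= ?u0//; move: Au;
    rewrite /clamp01 (min_l u1') (max_r u0).
Qed.

Definition coupling_prob : probability (vborel R n * measurableTypeR R)%type R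
  :=
  (tau \x unif)%E.

Definition coupling_J (q : vborel R n * measurableTypeR R) : 'I_K :=
  atom_index q.1.

Definition coupling_U (q : vborel R n * measurableTypeR R) : vborel R d :=
  const_mx (clamp01 q.2).

Lemma measurable_coupling_U : measurable_fun setT coupling_U.
Proof.
apply: measurable_fun_vborel => i; rewrite /coupling_U.
rewrite (_ : (fun x => _) = clamp01 \o snd).
  by apply: measurableT_comp; [exact: measurable_clamp01|exact: measurable_snd].
by apply/funext => q; rewrite mxE.
Qed.

Lemma coupling_probX (B : set (vborel R n)) (A : set (measurableTypeR R)) :
  measurable A -> measurable B ->
  coupling_prob (B `*` A) = (tau B * unif A)%E.
Proof. by move=> mA mB; exact: product_measure1E. Qed.

Lemma coupling_prob_J (B : set 'I_K) :
  coupling_prob (coupling_J @^-1` B) = tau (atom_index @^-1` B).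
Proof.
rewrite (_ : _ @^-1` _ = (atom_index @^-1` B) `*` setT).
  rewrite coupling_probX//; last exact: measurable_atom_index.
  by rewrite [X in (_ * X)%E](_ : _ = 1%E) ?mule1//;
    exact: (probability_setT unif).
by apply/seteqP; split=> q //= [].
Qed.

Lemma measurable_coupling_J (B : set 'I_K) : measurable (coupling_J @^-1` B).
Proof.
rewrite (_ : _ @^-1` _ = (atom_index @^-1` B) `*` setT).
  by apply: measurableX => //; exact: measurable_atom_index.
by apply/seteqP; split=> q //= [].
Qed.

Let cU (u : measurableTypeR R) : vborel R d := const_mx (clamp01 u).

Let mcU : measurable_fun setT cU.
Proof.
apply: measurable_fun_vborel => i; rewrite /cU.
rewrite (_ : (fun x => _) = clamp01); first exact: measurable_clamp01.
by apply/funext => q; rewrite mxE.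
Qed.

Lemma coupling_prob_U (A : set (vborel R d)) : measurable A ->
  coupling_prob (coupling_U @^-1` A) = unif (cU @^-1` A).
Proof.
move=> mA; have mcA : measurable (cU @^-1` A).
  by rewrite -[X in measurable X]setTI; exact: mcU.
rewrite (_ : _ @^-1` _ = setT `*` (cU @^-1` A)).
  rewrite coupling_probX//.
  by rewrite [X in (X * _)%E](_ : _ = 1%E) ?mul1e//;
    exact: (probability_setT tau).
by apply/seteqP; split=> q //= [].
Qed.

Lemma coupling_indep (A : set (vborel R d)) (B : set 'I_K) : measurable A ->
  coupling_prob (coupling_U @^-1` A `&` coupling_J @^-1` B) =
  (coupling_prob (coupling_U @^-1` A) * coupling_prob (coupling_J @^-1` B))%E.
Proof.
move=> mA; have mcA : measurable (cU @^-1` A).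
  by rewrite -[X in measurable X]setTI; exact: mcU.
rewrite (_ : _ `&` _ = (atom_index @^-1` B) `*` (cU @^-1` A)); last first.
  by apply/seteqP; split=> q [].
rewrite coupling_probX//; last exact: measurable_atom_index.
by rewrite coupling_prob_J coupling_prob_U// muleC.
Qed.

Lemma coupling_U_uniform i (A : set (measurableTypeR R)) : measurable A ->
  coupling_prob [set q | A ((coupling_U q : 'cV[R]_d) i 0)] = unif A.
Proof.
move=> mA; rewrite -uniform_clamp01//.
have mB : measurable ([set v : 'cV[R]_d | A (v i 0)] : set (vborel R d)).
  by have := measurable_coord i measurableT mA; rewrite setTI.
have := coupling_prob_U mB => h; apply: etrans h _.
by congr (unif _); apply/seteqP; split=> u /=; rewrite mxE.
Qed.

End CouplingSpace.

(** * Duality bounds *)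

Section Conclusion.
Context {R : realType} {d k1 n_in n_eq m_in m_eq k2 : nat}.
Variable D : dro_data R d k1 n_in n_eq m_in m_eq k2.
Hypothesis hD : dro_setting D.
Variables (tau : probability (vborel R (m_in + m_eq)) R).
Variables (xi_in : 'cV[R]_n_in) (xi_eq : 'cV[R]_n_eq).
Hypothesis hdual : dual_feasible D tau xi_in xi_eq.
Variables (K : nat) (lam : 'I_K -> 'cV[R]_(m_in + m_eq)).
Hypotheses (lamI : injective lam) (tau_lam : tau (range lam) = 1%E).
Hypothesis lamS : range lam `<=` S2star D.
Variables (x : 'cV[R]_k1) (hx : S1 D x).
Variables (f : 'I_d -> R -> R) (hf : forall i, C_cvx (f i)).
Variable eps_OT : R.
Hypothesis hC1 : forall l, supp tau l -> slack D x f l = 0.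
Hypothesis hC3 : dotv (L_in D *m x - q_in D) xi_in = 0.
Hypothesis hC4 : dotv (c1 D + QTmean D tau - (L_in D)^T *m xi_in
                 - (L_eq D)^T *m xi_eq) x = 0.
Hypothesis hC5 : forall i,
      (OT (omega_lo D i) (omega_hi D i) (marg D i) (law_dotv (p_ D i) tau)
         - eps_OT%:E
       <= - (\int[marg D i]_(w in Omega_ D i) conjugate (f i) w)
          - \int[law_dotv (p_ D i) tau]_z (f i z)%:E)%E.
Hypothesis hC6 : forall i z, subdiff (f i) z `<=` Omega_ D i.
Variables (mu : probability (vborel R d) R) (e : 'I_d -> R).
Hypothesis Gmu : Gamma D mu.
Hypothesis OTe : forall i, ((- (e i)%:E)%E <=
  OT (omega_lo D i) (omega_hi D i) (marg D i) (law_dotv (p_ D i) tau))%E.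

Let m := mean_atoms tau lam.

Hypothesis inner_ge : forall x', S1 D x' ->
  ((dotv (Q D *m x' + b D) m + \sum_i e i)%:E <= inner_obj D x' mu)%E.

Let I i := (\int[marg D i]_(w in Omega_ D i) conjugate (f i) w)%E.

Let F i := \sum_k f i (dotv (p_ D i) (lam k)) * weight tau lam k.

Lemma integral_law_dotv i :
  (\int[law_dotv (p_ D i) tau]_z (f i z)%:E = (F i)%:E)%E.
Proof.
have mf : measurable_fun setT (f i : measurableTypeR R -> measurableTypeR R).
  by apply: continuous_measurable_fun; case: (hf i).
have mp := @measurable_dotv R _ (p_ D i).
rewrite (@integral_law _ (vborel R (m_in + m_eq)) R _ (measurableTypeR R)
  (bdotv (p_ D i)) tau (law_dotv (p_ D i) tau) setT (fun z => (f i z)%:E) mp)//.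
- rewrite preimage_setT.
  apply: (integral_tau lamI tau_lam (g := fun l => f i (bdotv (p_ D i) l))) =>
    //.
  by apply: measurableT_comp.
- exact/measurable_EFinP.
Qed.

(** A lower bound on the transport cost turns the near optimality of [f i] into an
    upper bound on the integral of its conjugate, which is therefore finite. *)
Lemma conjugate_integral_le i : (I i <= (e i + eps_OT - F i)%:E)%E.
Proof.
have := le_trans (leeB (OTe i) (lexx eps_OT%:E)) (hC5 i).
rewrite integral_law_dotv -/(I i); have := conjugate_integral_gtNy hD (f i) i.
rewrite -/(I i); case: (I i) => [r _| |]//=.
by rewrite !lee_fin; lra.
Qed.

Lemma weight_supp k : ~ supp tau (lam k) -> weight tau lam k = 0.
Proof.
rewrite /supp/= => /existsNP[W] /not_implyP[oW] /not_implyP[Wk] /negP.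
rewrite -leNgt => W0.
suff h : tau [set lam k] = 0%E by rewrite /weight h.
apply/eqP; rewrite -measure_le0; apply: le_trans W0; apply: le_measure.
- by rewrite inE; exact: measurable_vborel_set1.
- by rewrite inE; exact: sub_sigma_algebra.
- by move=> _ ->.
Qed.

(** The slack vanishes on the support, and the other atoms have no mass. *)
Lemma sum_F : \sum_i F i = - dotv (Q D *m x + b D) m.
Proof.
rewrite /F exchange_big/= dotv_sumr -sumrN; apply: eq_bigr => k _.
rewrite -mulr_suml; have [sk|/weight_supp ->] := pselect (supp tau (lam k)).
  have := hC1 sk; rewrite /slack => /eqP; rewrite addrC addr_eq0 => /eqP ->.
  by rewrite mulNr.
by rewrite !mulr0 oppr0.
Qed.

Lemma sum_conjugate_integral_le :
  (\sum_i I i <= (dotv (Q D *m x + b D) m + \sum_i e i + d%:R * eps_OT)%:E)%E.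
Proof.
apply: (@le_trans _ _ (\sum_i (e i + eps_OT - F i)%:E)%E).
  by apply: lee_sum => i _; exact: conjugate_integral_le.
rewrite sumEFin lee_fin !big_split/= sumrN sum_F opprK sumr_const card_ord.
by rewrite -mulr_natl; lra.
Qed.

Let epsv := eps_vio D x f.

Let slack_le : forall l, S2star D l -> slack D x f l <= epsv.
Proof. by move=> l; exact: (slack_le_eps_vio hD hx hf hC6). Qed.

Let eps_sub := epsv + d%:R * eps_OT.

(* The value of the dual objective when the transport costs are those of the
   comonotone coupling. *)
Let dual_value := dotv (q_in D) xi_in + dotv (q_eq D) xi_eq + dotv (b D) m +
  \sum_i e i.

(** Evaluate the inner supremum at [mu], then use weak duality in the first
    stage. *)
Lemma dro_obj_ge x' : S1 D x' -> (dual_value%:E <= dro_obj D x')%E.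
Proof.
move=> Sx'; rewrite /dro_obj.
apply: (@le_trans _ _ ((dotv (c1 D) x')%:E + inner_obj D x' mu)%E); last first.
  by apply: leeD2l; apply: ereal_sup_ubound; exists mu.
apply: (@le_trans _ _ ((dotv (c1 D) x')%:E + (dotv (Q D *m x' + b D) m + \sum_i
  e i)%:E)%E); last first.
  by apply: leeD2l; exact: inner_ge.
rewrite -EFinD lee_fin dotvDl /dual_value.
have [_ _ xi0 hxi] := hdual; rewrite (QTmeanE lamI tau_lam lamS) in hxi.
by have := first_stage_ge Sx' xi0 hxi; rewrite -/m; lra.
Qed.

Lemma inner_sup_le x' (f' : 'I_d -> R -> R) r :
  (forall l, S2star D l -> slack D x' f' l <= r) ->
  (ereal_sup (inner_obj D x' @` Gamma D) <=
   r%:E + \sum_i \int[marg D i]_(w in Omega_ D i) conjugate (f' i) w)%E.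
Proof.
by move=> h; apply: ge_ereal_sup => _ [nu Gnu <-];
  exact: (inner_obj_le hD Gnu h).
Qed.

(** The constraint of the primal problem makes its objective an upper bound for
    that of the robust problem. *)
Lemma primal_obj_ge xf : primal_feasible D xf -> (dual_value%:E <=
  primal_obj D xf)%E.
Proof.
move=> [Sx' _ h]; apply: le_trans (dro_obj_ge Sx') _.
apply: leeD2l; apply: le_trans (inner_sup_le h) _.
by rewrite add0e.
Qed.

Lemma first_stage_value :
  dotv (c1 D) x + dotv (Q D *m x) m = dotv (q_in D) xi_in + dotv (q_eq D) xi_eq.
Proof.
apply: first_stage_eq => //.
by rewrite -(QTmeanE lamI tau_lam lamS).
Qed.

(** The near tightness of all the inequalities of weak duality at [(x, f)]. *)
Lemma objective_le :
  ((dotv (c1 D) x)%:E + (epsv%:E + \sum_i I i) <= (dual_value + eps_sub)%:E)%E.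
Proof.
apply: (@le_trans _ _ ((dotv (c1 D) x)%:E + (epsv%:E +
  (dotv (Q D *m x + b D) m + \sum_i e i + d%:R * eps_OT)%:E))%E).
  by apply: leeD2l; apply: leeD2l; exact: sum_conjugate_integral_le.
rewrite -!EFinD lee_fin dotvDl /dual_value /eps_sub.
by have := first_stage_value; lra.
Qed.

Lemma shift_firstE (c : R) i :
  shift_first f c i = (fun z => f i z - if val i == 0%N then c else 0).
Proof.
by apply/funext => z; rewrite /shift_first; case: ifP => // _; rewrite subr0.
Qed.

Lemma shift_first_integral_le i :
  (\int[marg D i]_(w in Omega_ D i) conjugate (shift_first f epsv i) w <=
   I i + (if val i == 0%N then epsv else 0)%:E)%E.
Proof.
have mO : measurable (Omega_ D i : set (measurableTypeR R)) by exact: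
  measurable_itv.
rewrite shift_firstE.
set c := if _ then _ else _.
have mcf (g : R -> R) : measurable_fun (Omega_ D i : set (measurableTypeR R))
    (conjugate g : measurableTypeR R -> \bar R).
  by apply: (@measurable_funTS _ _ (measurableTypeR R));
    exact: measurable_conjugate.
have icf : (marg D i).-integrable (Omega_ D i) (conjugate (f i)).
  apply: (@integrable_bounded_below _ (measurableTypeR R) R _ _ _ (- f i 0)) =>
    //.
    by move=> w _; rewrite (le_trans _ (conjugate_ge (f i) 0 _))// mul0r sub0r.
  by rewrite (le_lt_trans (conjugate_integral_le i))// ltry.
have -> : (I i + c%:E = \int[marg D i]_(w in Omega_ D i) (conjugate (f i) w +
  c%:E))%E.
  rewrite integralD//; last exact: finite_measure_integrable_cst.
  rewrite integral_cst// [X in (_ + _ * X)%E](_ : _ = 1%E) ?mule1//.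
  exact (marg_Omega hD i).
apply: le_integral_measurable => //.
  by apply: emeasurable_funD.
by move=> w _; exact: conjugate_subr.
Qed.

Lemma shift_first_sum (c : R) : \sum_(i < d) (if val i == 0%N then c else 0) =
  c.
Proof.
have d0 : (0 < d)%N by rewrite (leq_trans _ (d_ge2 hD)).
rewrite (bigD1 (Ordinal d0))//= big1 ?addr0// => i.
by rewrite -val_eqE/= => /negbTE ->.
Qed.

Lemma shift_first_feasible : primal_feasible D (x, shift_first f epsv).
Proof.
split=> /=; [exact: hx|move=> i|move=> l Sl].
  by rewrite shift_firstE; exact: C_cvx_subr.
have := slack_le Sl; rewrite -subr_le0; apply: le_trans.
rewrite /slack -addrA lerD2l -{2}(shift_first_sum epsv) -sumrB.
by apply: ler_sum => i _; rewrite shift_firstE.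
Qed.

Lemma primal_optimizer :
  eps_minimizer (primal_feasible D) (primal_obj D) eps_sub (x, shift_first f
    epsv).
Proof.
split; first exact: shift_first_feasible.
apply: (@le_trans _ _ (dual_value + eps_sub)%:E); last first.
  rewrite EFinD leeD2r//; apply: le_ereal_inf_tmp => _ [xf hxf <-].
  exact: primal_obj_ge.
apply: le_trans objective_le; rewrite /primal_obj/=; apply: leeD2l.
have -> : (epsv%:E + \sum_i I i =
    \sum_(i < d) (I i + (if val i == 0%N then epsv else 0)%:E))%E.
  by rewrite -[in LHS](shift_first_sum epsv) -sumEFin addeC -big_split.
by apply: lee_sum => i _; exact: shift_first_integral_le.
Qed.

Lemma dro_optimizer : eps_minimizer (S1 D) (dro_obj D) eps_sub x.
Proof.
split=> //; apply: (@le_trans _ _ (dual_value + eps_sub)%:E); last first.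
  rewrite EFinD leeD2r//; apply: le_ereal_inf_tmp => _ [x' hx' <-].
  exact: dro_obj_ge.
apply: le_trans objective_le; apply: leeD2l; exact: inner_sup_le.
Qed.

Lemma inner_optimizer : eps_maximizer (Gamma D) (inner_obj D x) eps_sub mu.
Proof.
split=> //; apply: le_trans (inner_sup_le slack_le) _.
apply: (@le_trans _ _ (epsv%:E +
  (dotv (Q D *m x + b D) m + \sum_i e i + d%:R * eps_OT)%:E)%E).
  by apply: leeD2l; exact: sum_conjugate_integral_le.
apply: (@le_trans _ _ ((dotv (Q D *m x + b D) m + \sum_i e i)%:E +
  eps_sub%:E)%E).
  by rewrite -!EFinD lee_fin /eps_sub; lra.
by apply: leeD2r; exact: inner_ge.
Qed.

End Conclusion.

Theorem corollary3p5 (R : realType) (d k1 n_in n_eq m_in m_eq k2 : nat)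
    (D : dro_data R d k1 n_in n_eq m_in m_eq k2)
    (hD : dro_setting D)
    (hDRO : (-oo < C_DRO D)%E)
    (tau : probability (vborel R (m_in + m_eq)) R)
    (xi_in : 'cV[R]_n_in) (xi_eq : 'cV[R]_n_eq)
    (hdual : dual_feasible D tau xi_in xi_eq)
    (hsupp : finite_set (supp tau))
    (V : set 'cV[R]_(m_in + m_eq))
    (hVfin : finite_set V)
    (hsuppV : supp tau `<=` V)
    (hVS2 : V `<=` S2star D)
    (x : 'cV[R]_k1) (hx : S1 D x)
    (f : 'I_d -> R -> R) (hf : forall i, C_cvx (f i))
    (eps_OT : R) (heps : 0 < eps_OT)
    (hC1 : forall l, supp tau l -> slack D x f l = 0)
    (hC2 : forall l, (V `\` supp tau) l -> slack D x f l <= 0)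
    (hC3 : dotv (L_in D *m x - q_in D) xi_in = 0)
    (hC4 : dotv (c1 D + QTmean D tau - (L_in D)^T *m xi_in
                 - (L_eq D)^T *m xi_eq) x = 0)
    (hC5 : forall i,
      (OT (omega_lo D i) (omega_hi D i) (marg D i) (law_dotv (p_ D i) tau)
         - eps_OT%:E
       <= - (\int[marg D i]_(w in Omega_ D i) conjugate (f i) w)
          - \int[law_dotv (p_ D i) tau]_z (f i z)%:E)%E)
    (hC6 : forall i z, subdiff (f i) z `<=` Omega_ D i) :
  let eps_sub : R := eps_vio D x f + d%:R * eps_OT in
  (eps_minimizer (primal_feasible D) (primal_obj D) eps_sub
     (x, shift_first f (eps_vio D x f)) /\
   eps_minimizer (S1 D) (dro_obj D) eps_sub x) /\
  (forall (K : nat) (lam : 'I_K -> 'cV[R]_(m_in + m_eq))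
     (sigma : 'I_d -> {perm 'I_K})
     (dX : measure_display) (X : measurableType dX) (Pr : probability X R)
     (J : X -> 'I_K) (U : {RV Pr >-> vborel R d}),
     injective lam -> range lam = V ->
     (forall i (j k : 'I_K), (j <= k)%N ->
        dotv (p_ D i) (lam (sigma i j)) <= dotv (p_ D i) (lam (sigma i k))) ->
     (forall B : set 'I_K, measurable (J @^-1` B)) ->
     (forall j, Pr (J @^-1` [set j]) = tau [set lam j]) ->
     (forall w i, (U w : 'cV[R]_d) i 0 \in `[0, 1]) ->
     (forall (A : set (vborel R d)) (B : set 'I_K), measurable A ->
        Pr (U @^-1` A `&` J @^-1` B) = (Pr (U @^-1` A) * Pr (J @^-1` B))%E) ->
     (forall i (A : set (measurableTypeR R)), measurable A ->
        Pr [set w | A ((U w : 'cV[R]_d) i 0)] = uniform_prob (@ltr01 R) A) ->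
     exists2 Y : {RV Pr >-> vborel R d},
       forall w, Y w = Yvec D tau lam sigma J U w &
       eps_maximizer (Gamma D) (inner_obj D x) eps_sub (distribution Pr Y)).
Proof.
move=> eps_sub.
have tauV K (lam : 'I_K -> 'cV[R]_(m_in + m_eq)) : range lam = V ->
  tau (range lam) = 1%E.
  move=> lamV; apply: supp_full; first by rewrite lamV.
  exact: (measurable_sub_range lam setT).
split; last first.
  move=> K lam sigma dX X Pr J U lamI lamV sorted_sigma mJ PJ U01 UJ uU.
  have tau_lam := tauV _ _ lamV.
  have lamS : range lam `<=` S2star D by rewrite lamV.
  have [Y YE] := coupling_RV hD lamI tau_lam sigma mJ U01.
  exists Y => //.
  apply: (inner_optimizer hD lamI tau_lam hx hf hC1 hC5 hC6
    (coupling_Gamma hD lamI tau_lam mJ PJ U01 UJ uU YE)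
    (coupling_OT hD lamI tau_lam sorted_sigma mJ PJ U01 UJ uU)) => x' _.
  exact: coupling_inner_obj.
have [K [lam [lamI lamV]]] := finite_set_enum 0 hVfin.
have tau_lam := tauV _ _ lamV.
have lamS : range lam `<=` S2star D by rewrite lamV.
have [k0 _] : exists k0 : 'I_K, True.
  have : range lam !=set0.
    apply/set0P/eqP => lam0; have := tau_lam; rewrite lam0 measure0 => /eqP.
    by rewrite eqe eq_sym oner_eq0.
  by case=> _ [k0 _ _]; exists k0.
have [sigma sorted_sigma] := choice (fun i => sorting_perm (fun k =>
  dotv (p_ D i) (lam k))).
pose Pr := coupling_prob tau.
pose U : {RV Pr >-> vborel R d} := MeasurableFun.Pack (MeasurableFun.Class
  (isMeasurableFun.Build _ _ (vborel R (m_in + m_eq) * measurableTypeR R)%type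
    (vborel R d) coupling_U measurable_coupling_U)).
pose J := coupling_J lam k0.
have mJ B : measurable (J @^-1` B) by exact: measurable_coupling_J.
have PJ k : Pr (J @^-1` [set k]) = tau [set lam k].
  by rewrite coupling_prob_J// tau_atom_index.
have U01 w i : (U w : 'cV[R]_d) i 0 \in `[0, 1].
  by rewrite /U/= mxE; exact: clamp01_itv.
have UJ (A : set (vborel R d)) (B : set 'I_K) : measurable A ->
    Pr (U @^-1` A `&` J @^-1` B) = (Pr (U @^-1` A) * Pr (J @^-1` B))%E.
  exact: coupling_indep.
have uU i (A : set (measurableTypeR R)) : measurable A ->
    Pr [set w | A ((U w : 'cV[R]_d) i 0)] = uniform_prob (@ltr01 R) A.
  exact: coupling_U_uniform.
have [Y YE] := coupling_RV hD lamI tau_lam sigma mJ U01.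
have G := coupling_Gamma hD lamI tau_lam mJ PJ U01 UJ uU YE.
have O := coupling_OT hD lamI tau_lam sorted_sigma mJ PJ U01 UJ uU.
have ge x' : S1 D x' -> _ :=
  fun _ => coupling_inner_obj hD lamI tau_lam mJ PJ U01 YE x' lamS.
split.
  exact: (primal_optimizer hD hdual lamI tau_lam lamS hx hf hC1 hC3 hC4 hC5 hC6
    G O ge).
exact: (dro_optimizer hD hdual lamI tau_lam lamS hx hf hC1 hC3 hC4 hC5 hC6 G O
  ge).
Qed.
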